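(* Let $\epsilon>0$ and $\eta=3^{3/2}2^{-1}$. The map sending $(a,b)\in\mathbf B_\epsilon$ to the coefficient $F_0$ of the unique sequence $F\in\ell^2(\mathbb Z)$ whose nonlinear Fourier series is $(a,b)$ is Lipschitz on $\mathbf B_\epsilon$ endowed with the metric induced by $\|(a,b)\|_{\mathcal H}=(\|a\|_{L^2(\mathbb T)}^2+\|b\|_{L^2(\mathbb T)}^2)^{1/2}$, with Lipschitz constant at most $(8+2^{5/2})(\eta\epsilon)^{-3/2}$.
   Context: $\mathbb T$ unit circle, $\mathbb D$ open unit disc, $\mathbb D^*=\{\overline z^{-1}:z\in\mathbb D\}\cup\{\infty\}$, $a^*(z)=\overline{a(\overline z^{-1})}$. $H^2(\mathbb D)$: functions in $L^2(\mathbb T)$ with vanishing negative Fourier coefficients; $H^2(\mathbb D^* )$: $f$ with $f^*\in H^2(\mathbb D)$, extended analytically to $\mathbb D^*$ with $f(\infty)=\overline{f^*(0)}$. Pairs multiply as $(a,b)(c,d)=(ac-bd^*,ad+bc^* )$. $\mathbf L$: pairs $(a,b)$ of measurable functions on $\mathbb T$ with $aa^*+bb^*=1$ a.e., $a\in H^2(\mathbb D^* )$, $a(\infty)>0$, with metric $\rho((a,b),(c,d))=\|a-c\|_{L^2}+\|b-d\|_{L^2}+|\log a(\infty)-\log c(\infty)|$. $\mathbf B$: $(a,b)\in\mathbf L$ with $\inf_{z\in\mathbb D^*}|a(z)|^2>\frac12$. $\mathbf B_\epsilon$: $(a,b)\in\mathbf B$ with $\inf_{z\in\mathbb D^*}|a(z)|\ge2^{-1/2}+\epsilon$.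 Nonlinear Fourier series: for finitely supported $G:\mathbb Z\to\mathbb C$, the first row $(a,b)$ of the ordered product $\prod_k(1+|G_k|^2)^{-1/2}\begin{pmatrix}1&G_kz^k\\-\overline{G_k}z^{-k}&1\end{pmatrix}$ ($k$ increasing left to right); for $F\in\ell^2(\mathbb Z)$, write $F=F_-+F_+$ with $F_-$ supported in $(-\infty,-1]$, $F_+$ in $[0,\infty)$, let $(a_\pm,b_\pm)$ be the $\rho$-limits of the nonlinear Fourier series of $F_+\mathbf 1_{[0,k]}$, resp. $F_-\mathbf 1_{[-k,-1]}$, and define the nonlinear Fourier series of $F$ as $(a_-,b_-)(a_+,b_+)$. Each $(a,b)\in\mathbf B$ is the nonlinear Fourier series of a unique $F\in\ell^2(\mathbb Z)$. *)

(* Defs.v *)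
From HB Require Import structures.
From mathcomp Require Import all_boot all_order all_algebra.
From mathcomp Require Import all_classical all_reals all_analysis.
From mathcomp Require Import complex.
Set Implicit Arguments. Unset Strict Implicit. Unset Printing Implicit Defensive.
Import Order.TTheory GRing.Theory Num.Theory.
Import numFieldNormedType.Exports.
Local Open Scope classical_set_scope.
Local Open Scope ring_scope.

Section NLFT.
Variable R : realType.
Local Notation C := R[i].

Definition cabs (z : C) : R := Num.sqrt (complex.Re z ^+ 2 + complex.Im z ^+ 2).

Definition toC (x : R) : C := Complex x 0.

Definition cconj (z : C) : C := Complex (complex.Re z) (- complex.Im z).

Definition eT (t : R) : C := Complex (cos (2 * pi * t)) (sin (2 * pi * t)).

(* Lebesgue measure on [0,1]: normalised arc-length measure on T *)
Definition I01 : set R := `[0, 1].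
Local Notation mu := (@lebesgue_measure R).

(* functions on T are represented by functions C -> C (only the values on T matter
   for L^2 objects) *)

Definition star (f : C -> C) : C -> C := fun z => cconj (f (cconj z)^-1).

Definition isL2 (f : C -> C) : Prop :=
  measurable_fun I01 (fun t => complex.Re (f (eT t))) /\
  measurable_fun I01 (fun t => complex.Im (f (eT t))) /\
  mu.-integrable I01 (fun t => ((cabs (f (eT t))) ^+ 2)%:E).

Definition L2norm (f : C -> C) : R :=
  Num.sqrt (Rintegral mu I01 (fun t => (cabs (f (eT t))) ^+ 2)).

Definition fcoef (f : C -> C) (n : int) : C :=
  Complex (Rintegral mu I01 (fun t => complex.Re (f (eT t) * (eT t) ^ (- n))))
          (Rintegral mu I01 (fun t => complex.Im (f (eT t) * (eT t) ^ (- n)))).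

Definition aeT (P : C -> Prop) : Prop :=
  {ae mu, forall t, I01 t -> P (eT t)}.

(* H^2(Dstar): fstar in H^2(D), i.e. f in L^2 with vanishing positive Fourier coefficients *)
Definition inH2Dstar (f : C -> C) : Prop :=
  isL2 f /\ forall n : int, (0 < n)%R -> fcoef f n = 0.

(* analytic extension of f in H^2(Dstar) to {|z| > 1}:
   f(z) = sum_{n >= 0} \hat f(-n) z^{-n} *)
Definition ext_term (f : C -> C) (z : C) (n : nat) : C :=
  fcoef f (- (n%:Z)) * z ^ (- (n%:Z)).
Definition ext_fin (f : C -> C) (z : C) : C :=
  Complex (limn (fun N : nat => \sum_(n < N) complex.Re (ext_term f z n)))
          (limn (fun N : nat => \sum_(n < N) complex.Im (ext_term f z n))).
(* value at infinity: f(oo) = conj (fstar(0)) = \hat f(0) *)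
Definition ext_inf (f : C -> C) : C := fcoef f 0.

Definition inL (a b : C -> C) : Prop :=
  isL2 a /\ isL2 b /\
  aeT (fun z => a z * star a z + b z * star b z = 1) /\
  inH2Dstar a /\ (0 < ext_inf a)%R.

Definition rho (p q : (C -> C) * (C -> C)) : R :=
  L2norm (fun z => p.1 z - q.1 z) + L2norm (fun z => p.2 z - q.2 z)
  + `| ln (complex.Re (ext_inf p.1)) - ln (complex.Re (ext_inf q.1)) |.

Definition inB (a b : C -> C) : Prop :=
  inL a b /\
  exists delta : R, (1 / 2 < delta)%R /\
    (forall z : C, (1 < cabs z)%R -> delta <= cabs (ext_fin a z) ^+ 2) /\
    delta <= cabs (ext_inf a) ^+ 2.

Definition inBeps (eps : R) (a b : C -> C) : Prop :=
  inB a b /\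
  (forall z : C, (1 < cabs z)%R -> Num.sqrt (2^-1) + eps <= cabs (ext_fin a z)) /\
  Num.sqrt (2^-1) + eps <= cabs (ext_inf a).

Definition ell2 (F : int -> C) : Prop :=
  exists M : R, forall N : nat,
    \sum_(n < N) (cabs (F n%:Z) ^+ 2 + cabs (F (- (n.+1)%:Z)) ^+ 2) <= M.

Definition nlft_factor (g : C) (k : int) (z : C) : 'M[C]_2 :=
  toC (Num.sqrt (1 + cabs g ^+ 2))^-1 *:
  \matrix_(i < 2, j < 2)
     (if (i == 0) && (j == 0) then 1
      else if (i == 0) then g * z ^ k
      else if (j == 0) then - (cconj g * z ^ (- k))
      else 1).

Definition nlft_window (F : int -> C) (m : int) (N : nat) : (C -> C) * (C -> C) :=
  (fun z => (\prod_(i < N) nlft_factor (F (m + i%:Z)) (m + i%:Z) z) 0 0,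
   fun z => (\prod_(i < N) nlft_factor (F (m + i%:Z)) (m + i%:Z) z) 0 1).

Definition is_nlft (F : int -> C) (a b : C -> C) : Prop :=
  exists ap bp am bm : C -> C,
    inL ap bp /\ inL am bm /\
    ((fun k : nat => rho (nlft_window F 0 k.+1) (ap, bp)) @ \oo --> (0 : R)) /\
    ((fun k : nat => rho (nlft_window F (- k%:Z) k) (am, bm)) @ \oo --> (0 : R)) /\
    (* (a, b) = (a_-, b_-)(a_+, b_+) *)
    aeT (fun z => a z = am z * ap z - bm z * star bp z) /\
    aeT (fun z => b z = am z * bp z + bm z * star ap z).

End NLFT.

(* Main.v *)
(* The product relation (a, b) = (a_-, b_-)(a_+, b_+) says that the right factor,
   normalised as alpha = A a_+^*, beta = A b_+ with A = a_+(oo), satisfies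
     alpha + r beta^* = U,   beta - r alpha^* = V,   r = b / a,
   where U - 1 and V have only negative frequencies, while alpha and beta have only
   nonnegative ones; moreover F_0 = beta^(0) / alpha^(0).  The real-linear operator
   (alpha, beta) |-> (r beta^*, - r alpha^* ) is antisymmetric, so pairing the
   difference of two such systems with (alpha - alpha', beta - beta') gives
   |alpha - alpha'|^2 + |beta - beta'|^2 <= |r - r'|^2 in L^2, and r is Lipschitz
   in (a, b) because |a| >= 2^(-1/2).  This yields the Lipschitz constant 8, and
   eta eps <= 1 because eps <= 1 - 2^(-1/2).
   That a_- / a and b_- / a have no positive frequencies is where the lower bound
   on a outside the disc enters: a is the L^2-limit of polynomials in 1/z without
   zeros in |z| >= 1, and dividing by one linear factor 1/z - r with |r| > 1
   preserves the absence of positive frequencies. *)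
Require Import Defs.
From HB Require Import structures.
From mathcomp Require Import all_boot all_order all_algebra.
From mathcomp Require Import all_classical all_reals all_analysis.
From mathcomp Require Import measurable_realfun complex.
From mathcomp Require Import ring lra zify.
Set Implicit Arguments. Unset Strict Implicit. Unset Printing Implicit Defensive.
Import Order.TTheory GRing.Theory Num.Theory.
Import numFieldNormedType.Exports.
Local Open Scope classical_set_scope.
Local Open Scope ring_scope.

(** The factor [A] makes the pairing possible: it normalises the constant coefficient of U to 1
    whatever (a, b) is, so the right-hand sides of two systems differ by functions with negative
    frequencies only, orthogonal to the differences of the unknowns. Antisymmetry is applied to r
    alone; what remains is r - r' acting on the second solution, whose pointwise size is at most 1.
    The obstacle is the division by a. A lower bound on the circle does not suffice, since a zero of
    a outside the disc can create positive frequencies in a_- / a. The polynomials are truncated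
    Abel means: damping by s < 1 moves the boundary function to the extension of a at radius at
    least 1/s, where the lower bound has the margin eps, and this margin absorbs the truncation
    error. Frequency conditions are used asymmetrically: in an inner product one function has
    vanishing coefficients, the other is an L^2-limit of trigonometric polynomials. Neither
    Parseval's identity nor boundary values are needed. *)

Section RealIntegrals.
Variable R : realType.
Local Notation mu := (@lebesgue_measure R).
Local Notation I01 := (@I01 R).
Implicit Types f g : R -> R.

(** * Integration of essentially bounded real functions on the unit interval *)

Definition ae01 (P : R -> Prop) : Prop := {ae mu, forall t, I01 t -> P t}.

Local Instance ae_filter01 : Filter (nbhs (almost_everywhere mu)) :=
  ae_filter_ringOfSetsType mu.

Lemma ae01W (P : R -> Prop) : (forall t, P t) -> ae01 P.
Proof.
move=> h; rewrite /ae01; apply: filterE => t _.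
exact: h.
Qed.

Lemma ae01_imp (P Q : R -> Prop) : (forall t, P t -> Q t) -> ae01 P -> ae01 Q.
Proof.
rewrite /ae01 => h hP; apply: filterS hP => t Pt It.
exact: h (Pt It).
Qed.

Lemma ae01_imp2 (P1 P2 Q : R -> Prop) :
  (forall t, P1 t -> P2 t -> Q t) -> ae01 P1 -> ae01 P2 -> ae01 Q.
Proof.
rewrite /ae01 => h hP1 hP2; apply: filterS2 hP1 hP2 => t p1 p2 It.
exact: h (p1 It) (p2 It).
Qed.

Lemma ae01_and (P1 P2 : R -> Prop) : ae01 P1 -> ae01 P2 -> ae01 (fun t => P1 t /\ P2 t).
Proof. exact: ae01_imp2. Qed.

(** The relation |a|^2 + |b|^2 = 1 bounds all functions of the proof. Boundedness, unlike square
    integrability, passes to products, so it serves as the one integrability condition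
    throughout. *)
Definition Linf f : Prop :=
  measurable_fun I01 f /\ exists M : R, ae01 (fun t => `|f t| <= M).

Definition int01 f : R := Rintegral mu I01 f.

Lemma measurable_I01 : measurable I01. Proof. exact: measurable_itv. Qed.
Hint Resolve measurable_I01 : core.

Lemma mu_I01 : mu I01 = 1%E.
Proof. by rewrite /I01 lebesgue_measure_itv /= lte_fin ltr01 oppr0 adde0. Qed.

Lemma Linf_cst c : Linf (fun=> c).
Proof. by split; [exact: measurable_cst | exists `|c|; exact: ae01W]. Qed.

Lemma LinfD f g : Linf f -> Linf g -> Linf (fun t => f t + g t).
Proof.
move=> [mf [M hM]] [mg [N hN]]; split; first exact: measurable_funD.
exists (M + N); apply: ae01_imp2 hM hN => t fM gN.
by rewrite (le_trans (ler_normD _ _))// lerD.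
Qed.

Lemma LinfM f g : Linf f -> Linf g -> Linf (fun t => f t * g t).
Proof.
move=> [mf [M hM]] [mg [N hN]]; split; first exact: measurable_funM.
exists (M * N); apply: ae01_imp2 hM hN => t fM gN.
by rewrite normrM ler_pM.
Qed.

Lemma LinfN f : Linf f -> Linf (fun t => - f t).
Proof.
move=> [mf [M hM]]; split; first exact: measurable_funN.
by exists M; apply: ae01_imp hM => t; rewrite normrN.
Qed.

Lemma LinfB f g : Linf f -> Linf g -> Linf (fun t => f t - g t).
Proof. by move=> hf /LinfN hg; exact: LinfD. Qed.

Lemma Linf_max f c : Linf f -> Linf (fun t => Num.max c (f t)).
Proof.
move=> [mf [M hM]]; split.
  exact: (measurable_maxr (@measurable_cst _ _ _ _ _ c)).
exists (Num.max `|c| M); apply: ae01_imp hM => t fM.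
by rewrite /Num.max; case: ifP; case: ifP => //; lra.
Qed.

Lemma Linf_sqrt f : Linf f -> Linf (fun t => Num.sqrt (f t)).
Proof.
move=> [mf [M hM]]; split.
  apply: (measurableT_comp _ mf); apply: continuous_measurable_fun.
  exact: sqrt_continuous.
exists (Num.sqrt M); apply: ae01_imp hM => t fM.
by rewrite ger0_norm ?sqrtr_ge0// ler_wsqrtr// (le_trans (ler_norm _)).
Qed.

Lemma Linf_inv f (m : R) : 0 < m -> (forall t, 0 <= f t) ->
  ae01 (fun t => m <= f t) -> Linf f -> Linf (fun t => (f t)^-1).
Proof.
move=> m0 f0 hm [mf _]; split.
  (* On nonnegative reals inversion is the power -1, which is a measurable function. *)
  rewrite (_ : (fun t => _) = (fun t => f t `^ (-1))).
    exact: (measurableT_comp (@measurable_powR R (-1)) mf).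
  by apply/funext => t; rewrite powR_inv1.
exists m^-1; apply: ae01_imp hm => t mt.
rewrite ger0_norm ?invr_ge0// lef_pV2// posrE//.
exact: lt_le_trans mt.
Qed.

Lemma Linf_integrable f : Linf f -> mu.-integrable I01 (EFin \o f).
Proof.
move=> [mf [M hM]]; apply/integrableP; split; first exact/measurable_EFinP.
apply: (@le_lt_trans _ _ (\int[mu]_(x in I01) (cst (`|M|)%:E x))%E).
  apply: ae_ge0_le_integral => //=.
  - by do 2 apply: measurableT_comp => //; exact/measurable_EFinP.
  - move: hM; rewrite /ae01; apply: filterS => t /[apply] /= h.
    by rewrite lee_fin (le_trans h)// ler_norm.
by rewrite integral_cst// [X in (_ * X)%E]mu_I01 mule1 ltry.
Qed.

Lemma int01_ext f g : (forall t, f t = g t) -> int01 f = int01 g.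
Proof. by move=> /funext ->. Qed.

Lemma int01_cst c : int01 (fun=> c) = c.
Proof. by rewrite /int01 Rintegral_cst// [X in fine X]mu_I01 /= mulr1. Qed.

Lemma int01D f g : Linf f -> Linf g ->
  int01 (fun t => f t + g t) = int01 f + int01 g.
Proof. by move=> hf hg; rewrite /int01 RintegralD//; exact: Linf_integrable. Qed.

Lemma int01Z c f : Linf f -> int01 (fun t => c * f t) = c * int01 f.
Proof. by move=> hf; rewrite /int01 RintegralZl//; exact: Linf_integrable. Qed.

Lemma int01N f : Linf f -> int01 (fun t => - f t) = - int01 f.
Proof.
by move=> hf; rewrite -mulN1r -int01Z//; apply: int01_ext => t; rewrite mulN1r.
Qed.

Lemma int01B f g : Linf f -> Linf g ->
  int01 (fun t => f t - g t) = int01 f - int01 g.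
Proof. by move=> hf hg; rewrite int01D ?int01N//; exact: LinfN. Qed.

Lemma int01_ae_eq f g : Linf f -> Linf g -> ae01 (fun t => f t = g t) ->
  int01 f = int01 g.
Proof.
move=> [mf _] [mg _] fg; congr fine; apply: ae_eq_integral => //.
- exact/measurable_EFinP.
- exact/measurable_EFinP.
- by move: fg; rewrite /ae01; apply: filterS => t h /h /= ->.
Qed.

Lemma int01_le f g : Linf f -> Linf g -> ae01 (fun t => f t <= g t) ->
  int01 f <= int01 g.
Proof.
move=> hf hg fg; rewrite -subr_ge0 -int01B//.
have hgf := LinfB hg hf.
(* The difference is nonnegative only almost everywhere; its positive part has the same integral and
   is nonnegative everywhere. *)
rewrite (int01_ae_eq hgf (Linf_max 0 hgf)).
  by apply: Rintegral_ge0 => t _; rewrite le_max lexx.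
apply: ae01_imp fg => t fg; rewrite /Num.max; case: ifP; lra.
Qed.

Lemma int01_ge0 f : (forall t, 0 <= f t) -> 0 <= int01 f.
Proof. by move=> h; exact: Rintegral_ge0. Qed.

Lemma int01_eq0 f : Linf f -> (forall t, 0 <= f t) -> int01 f = 0 ->
  ae01 (fun t => f t = 0).
Proof.
move=> hf f0 intf.
have intf' : (\int[mu]_(x in I01) `|(EFin \o f) x| = 0)%E.
  transitivity (\int[mu]_(x in I01) (EFin \o f) x)%E.
    by apply: eq_integral => t _; rewrite /= ger0_norm.
  rewrite -[LHS]fineK; first by rewrite [fine _]intf.
  exact: integrable_fin_num (Linf_integrable hf).
have mf : measurable_fun I01 (EFin \o f) by apply/measurable_EFinP; case: hf.
have /(_ intf') := (ae_eq_integral_abs mu measurable_I01 mf).1.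
by rewrite /ae01; apply: filterS => t h /h /= [].
Qed.

End RealIntegrals.
#[export] Hint Resolve Linf_cst : core.

(** * Complex integrals, the L^2 inner product and the Cauchy-Schwarz inequality *)

Section ComplexIntegrals.
Variable R : realType.
Local Notation C := R[i].
Local Notation mu := (@lebesgue_measure R).
Local Notation I01 := (@I01 R).
Implicit Types (f g h : R -> C) (z w : C).

(** Squared modulus with real values: without the root, estimates become polynomial in real and
    imaginary parts. *)
Definition sqn z : R := complex.Re z ^+ 2 + complex.Im z ^+ 2.

Lemma cabsE z : cabs z = Num.sqrt (sqn z). Proof. by []. Qed.

Lemma cconjE z : cconj z = conjc z. Proof. by case: z. Qed.

Lemma sqn_ge0 z : 0 <= sqn z. Proof. by rewrite /sqn addr_ge0 ?sqr_ge0. Qed.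

Lemma sqr_cabs z : cabs z ^+ 2 = sqn z.
Proof. by rewrite sqr_sqrtr// sqn_ge0. Qed.

Lemma sqnE z : toC (sqn z) = z * conjc z.
Proof. by case: z => x y; rewrite /toC /sqn /=; congr Complex; ring. Qed.

Lemma sqn_eq0 z : (sqn z == 0) = (z == 0).
Proof.
by case: z => x y; rewrite /sqn eq_complex /= paddr_eq0 ?sqr_ge0// !sqrf_eq0.
Qed.

Lemma sqnM z w : sqn (z * w) = sqn z * sqn w.
Proof. by case: z w => [x y] [x' y']; rewrite /sqn /=; ring. Qed.

Lemma sqnN z : sqn (- z) = sqn z.
Proof. by case: z => x y; rewrite /sqn /=; ring. Qed.

Lemma conjcD z w : conjc (z + w) = conjc z + conjc w.
Proof. exact: rmorphD. Qed.

Lemma conjcN z : conjc (- z) = - conjc z.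
Proof. exact: rmorphN. Qed.

Lemma conjcB z w : conjc (z - w) = conjc z - conjc w.
Proof. exact: rmorphB. Qed.

Lemma conjcM z w : conjc (z * w) = conjc z * conjc w.
Proof. exact: rmorphM. Qed.

Lemma sqn_conj z : sqn (conjc z) = sqn z.
Proof. by case: z => x y; rewrite /sqn /=; ring. Qed.

Lemma sqn0 : sqn 0 = 0. Proof. by rewrite /sqn /=; ring. Qed.

Lemma sqn1 : sqn 1 = 1. Proof. by rewrite /sqn /=; ring. Qed.

Lemma sqnV z : sqn z^-1 = (sqn z)^-1.
Proof.
have [->|z0] := eqVneq z 0; first by rewrite invr0 sqn0 invr0.
have s0 : sqn z != 0 by rewrite sqn_eq0.
by apply: (mulfI s0); rewrite -sqnM !divff// sqn1.
Qed.

Lemma sqnD_le z w : sqn (z + w) <= 2 * (sqn z + sqn w).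
Proof.
case: z w => [x y] [x' y']; rewrite /sqn /=.
by have := sqr_ge0 (x - x'); have := sqr_ge0 (y - y'); nra.
Qed.

Lemma sqn_toC (x : R) : sqn (toC x) = x ^+ 2.
Proof. by rewrite /sqn /=; ring. Qed.

Lemma invcE z : z^-1 = toC (sqn z)^-1 * conjc z.
Proof.
have [->|z0] := eqVneq z 0; first by rewrite conjc0 mulr0 invr0.
have s0 : sqn z != 0 by rewrite sqn_eq0.
apply: (mulfI z0); rewrite divff// mulrCA -sqnE.
by rewrite /toC; congr Complex; field.
Qed.

Definition cLinf f : Prop :=
  Linf (fun t => complex.Re (f t)) /\ Linf (fun t => complex.Im (f t)).

Lemma cLinf_cst z : cLinf (fun=> z).
Proof. by split. Qed.

Lemma cLinf_ext f g : (forall t, f t = g t) -> cLinf f -> cLinf g.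
Proof. by move=> /funext ->. Qed.

Lemma cLinfD f g : cLinf f -> cLinf g -> cLinf (fun t => f t + g t).
Proof.
move=> [f1 f2] [g1 g2]; split.
- by have := LinfD f1 g1; congr Linf; apply/funext => t; case: (f t) (g t) => ? ? [].
- by have := LinfD f2 g2; congr Linf; apply/funext => t; case: (f t) (g t) => ? ? [].
Qed.

Lemma cLinfN f : cLinf f -> cLinf (fun t => - f t).
Proof.
move=> [f1 f2]; split.
- by have := LinfN f1; congr Linf; apply/funext => t; case: (f t).
- by have := LinfN f2; congr Linf; apply/funext => t; case: (f t).
Qed.

Lemma cLinfB f g : cLinf f -> cLinf g -> cLinf (fun t => f t - g t).
Proof. by move=> hf /cLinfN hg; exact: cLinfD. Qed.

Lemma cLinfM f g : cLinf f -> cLinf g -> cLinf (fun t => f t * g t).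
Proof.
move=> [f1 f2] [g1 g2]; split.
- have := LinfB (LinfM f1 g1) (LinfM f2 g2); congr Linf.
  by apply/funext => t; case: (f t) (g t) => ? ? [].
- have := LinfD (LinfM f1 g2) (LinfM f2 g1); congr Linf.
  by apply/funext => t; case: (f t) (g t) => ? ? [].
Qed.

Lemma cLinf_conj f : cLinf f -> cLinf (fun t => conjc (f t)).
Proof.
move=> [f1 f2]; split.
- by move: f1; congr Linf; apply/funext => t; case: (f t).
- by have := LinfN f2; congr Linf; apply/funext => t; case: (f t).
Qed.

Lemma cLinf_real (u : R -> R) : Linf u -> cLinf (fun t => toC (u t)).
Proof. by move=> hu; split; [exact: hu | exact: (Linf_cst 0)]. Qed.

Lemma Linf_sqn f : cLinf f -> Linf (fun t => sqn (f t)).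
Proof.
by move=> [f1 f2]; exact: LinfD (LinfM f1 f1) (LinfM f2 f2).
Qed.

Lemma cLinf_sum (I : Type) (s : seq I) (F : I -> R -> C) :
  (forall i, cLinf (F i)) -> cLinf (fun t => \sum_(i <- s) F i t).
Proof.
move=> hF; elim: s => [|i s ih].
  by apply: cLinf_ext (cLinf_cst 0) => t; rewrite big_nil.
by apply: cLinf_ext (cLinfD (hF i) ih) => t; rewrite big_cons.
Qed.

Lemma cLinf_inv f (m : R) : 0 < m -> ae01 (fun t => m <= sqn (f t)) ->
  cLinf f -> cLinf (fun t => (f t)^-1).
Proof.
move=> m0 hm hf; apply: cLinf_ext (fun t => esym (invcE (f t))) _.
apply: cLinfM; last exact: cLinf_conj.
by apply: cLinf_real; apply: (Linf_inv m0) => //; [move=> t; exact: sqn_ge0 | exact: Linf_sqn].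
Qed.

Lemma cLinf_bounded f (M : R) :
  measurable_fun I01 (fun t => complex.Re (f t)) ->
  measurable_fun I01 (fun t => complex.Im (f t)) ->
  ae01 (fun t => sqn (f t) <= M) -> cLinf f.
Proof.
(* The witness comes from |x| <= x^2 + 1, which avoids a root of [M]. *)
move=> m1 m2 hM; split; split => //; exists (M + 1); apply: ae01_imp hM => t;
  rewrite /sqn => h; rewrite ler_norml; apply/andP; split;
  have := sqr_ge0 (complex.Re (f t)); have := sqr_ge0 (complex.Im (f t));
  have := sqr_ge0 (complex.Re (f t) - 1); have := sqr_ge0 (complex.Re (f t) + 1);
  have := sqr_ge0 (complex.Im (f t) - 1); have := sqr_ge0 (complex.Im (f t) + 1);
  nra.
Qed.

Lemma addComplex (x y x' y' : R) :
  Complex x y + Complex x' y' = Complex (x + x') (y + y').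
Proof. by []. Qed.

Lemma mulComplex (x y x' y' : R) :
  Complex x y * Complex x' y' = Complex (x * x' - y * y') (x * y' + y * x').
Proof. by []. Qed.

Definition cint f : C :=
  Complex (int01 (fun t => complex.Re (f t))) (int01 (fun t => complex.Im (f t))).

Lemma cint_ext f g : (forall t, f t = g t) -> cint f = cint g.
Proof. by move=> /funext ->. Qed.

Lemma cint_cst z : cint (fun=> z) = z.
Proof. by rewrite /cint !int01_cst; case: z. Qed.

Lemma cint_ae_eq f g : cLinf f -> cLinf g -> ae01 (fun t => f t = g t) ->
  cint f = cint g.
Proof.
move=> [f1 f2] [g1 g2] fg; congr Complex; apply: int01_ae_eq => //;
  by apply: ae01_imp fg => t ->.
Qed.

Lemma cintD f g : cLinf f -> cLinf g ->
  cint (fun t => f t + g t) = cint f + cint g.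
Proof.
move=> [f1 f2] [g1 g2]; rewrite /cint addComplex -!int01D//.
by congr Complex; apply: int01_ext => t; case: (f t) (g t) => ? ? [].
Qed.

Lemma cintZ z f : cLinf f -> cint (fun t => z * f t) = z * cint f.
Proof.
case: z => x y [f1 f2]; rewrite /cint mulComplex.
rewrite -[x * int01 _ - _](_ : int01 (fun t => x * complex.Re (f t) - y * complex.Im (f t)) = _);
  last by rewrite int01B ?int01Z//; exact: LinfM.
rewrite -[x * int01 _ + _](_ : int01 (fun t => x * complex.Im (f t) + y * complex.Re (f t)) = _);
  last by rewrite int01D ?int01Z//; exact: LinfM.
by congr Complex; apply: int01_ext => t; case: (f t).
Qed.

Lemma cintN f : cLinf f -> cint (fun t => - f t) = - cint f.
Proof.
by move=> hf; rewrite -mulN1r -cintZ//; apply: cint_ext => t; rewrite mulN1r.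
Qed.

Lemma cintB f g : cLinf f -> cLinf g ->
  cint (fun t => f t - g t) = cint f - cint g.
Proof. by move=> hf hg; rewrite cintD ?cintN//; exact: cLinfN. Qed.

Lemma cint_conj f : cLinf f -> cint (fun t => conjc (f t)) = conjc (cint f).
Proof.
move=> [f1 f2]; rewrite /cint /= -int01N//.
by congr Complex; apply: int01_ext => t; case: (f t).
Qed.

Lemma cint_real (u : R -> R) : cint (fun t => toC (u t)) = toC (int01 u).
Proof. by rewrite /cint /= int01_cst. Qed.

Definition ip f g : C := cint (fun t => f t * conjc (g t)).
Definition n2 f : R := int01 (fun t => sqn (f t)).

Lemma n2_ge0 f : 0 <= n2 f.
Proof. by apply: int01_ge0 => t; exact: sqn_ge0. Qed.

Lemma ip_self f : ip f f = toC (n2 f).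
Proof. by rewrite /n2 -cint_real; apply: cint_ext => t; rewrite sqnE. Qed.

Lemma ipC f g : cLinf f -> cLinf g -> ip g f = conjc (ip f g).
Proof.
move=> hf hg; rewrite -cint_conj; last exact: cLinfM (cLinf_conj _).
by apply: cint_ext => t; rewrite rmorphM /= conjcK mulrC.
Qed.

Lemma ipDl f g h : cLinf f -> cLinf g -> cLinf h ->
  ip (fun t => f t + g t) h = ip f h + ip g h.
Proof.
move=> hf hg /cLinf_conj hh; rewrite /ip -cintD; try exact: cLinfM.
by apply: cint_ext => t; rewrite mulrDl.
Qed.

Lemma ipZl z f h : cLinf f -> cLinf h ->
  ip (fun t => z * f t) h = z * ip f h.
Proof.
move=> hf /cLinf_conj hh; rewrite /ip -cintZ; try exact: cLinfM.
by apply: cint_ext => t; rewrite mulrA.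
Qed.

Lemma ipBl f g h : cLinf f -> cLinf g -> cLinf h ->
  ip (fun t => f t - g t) h = ip f h - ip g h.
Proof.
move=> hf hg /cLinf_conj hh; rewrite /ip -cintB; try exact: cLinfM.
by apply: cint_ext => t; rewrite mulrBl.
Qed.

Lemma ipDr f g h : cLinf f -> cLinf g -> cLinf h ->
  ip h (fun t => f t + g t) = ip h f + ip h g.
Proof.
move=> hf hg hh; rewrite (ipC (cLinfD hf hg) hh) ipDl// rmorphD /=.
by rewrite (ipC hf hh) (ipC hg hh).
Qed.

Lemma ipZr z f h : cLinf f -> cLinf h ->
  ip h (fun t => z * f t) = conjc z * ip h f.
Proof.
move=> hf hh; rewrite (ipC (cLinfM (cLinf_cst z) hf) hh) ipZl// rmorphM /=.
by rewrite (ipC hf hh).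
Qed.

Lemma ipBr f g h : cLinf f -> cLinf g -> cLinf h ->
  ip h (fun t => f t - g t) = ip h f - ip h g.
Proof.
move=> hf hg hh; rewrite (ipC (cLinfB hf hg) hh) ipBl// rmorphB /=.
by rewrite (ipC hf hh) (ipC hg hh).
Qed.

Lemma n2_le f g : cLinf f -> cLinf g -> ae01 (fun t => sqn (f t) <= sqn (g t)) ->
  n2 f <= n2 g.
Proof. by move=> hf hg; apply: int01_le; exact: Linf_sqn. Qed.

Lemma n2D_le f g : cLinf f -> cLinf g ->
  n2 (fun t => f t + g t) <= 2 * (n2 f + n2 g).
Proof.
move=> hf hg; have [sf sg] := (Linf_sqn hf, Linf_sqn hg).
rewrite /n2 -int01D// -int01Z; last exact: LinfD.
apply: int01_le; first exact/Linf_sqn/cLinfD.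
  by apply: LinfM => //; exact: LinfD.
by apply: ae01W => t; exact: sqnD_le.
Qed.

Lemma n2Z z f : cLinf f -> n2 (fun t => z * f t) = sqn z * n2 f.
Proof.
move=> hf; rewrite /n2 -int01Z; last exact: Linf_sqn.
by apply: int01_ext => t; rewrite sqnM.
Qed.

Lemma n2N f : n2 (fun t => - f t) = n2 f.
Proof. by apply: int01_ext => t; rewrite sqnN. Qed.

Lemma n2_conj f : n2 (fun t => conjc (f t)) = n2 f.
Proof. by apply: int01_ext => t; rewrite sqn_conj. Qed.

Lemma n2B_expand f g : cLinf f -> cLinf g ->
  n2 (fun t => f t - g t) = n2 f - 2 * complex.Re (ip f g) + n2 g.
Proof.
move=> hf hg.
have : toC (n2 (fun t => f t - g t)) = toC (n2 f) - ip f g - ip g f + toC (n2 g).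
  rewrite -!ip_self ipBl ?ipBr//; last exact: cLinfB.
  by ring.
rewrite (ipC hf hg) => /(congr1 (@complex.Re R)) /=.
by case: (ip f g) => x y /= ->; ring.
Qed.

Lemma ip_CS f g : cLinf f -> cLinf g -> sqn (ip f g) <= n2 f * n2 g.
Proof.
move=> hf hg; set c := ip f g.
(* The squared norm of f - k c g for real k; a quadratic in k that is nonnegative everywhere. *)
have key (k : R) : 0 <= n2 f - 2 * k * sqn c + k ^+ 2 * sqn c * n2 g.
  have := n2_ge0 (fun t => f t - (toC k * c) * g t).
  rewrite n2B_expand//; last exact: cLinfM (cLinf_cst _) hg.
  rewrite n2Z// ipZr// -/c sqnM sqn_toC.
  have -> : complex.Re (conjc (toC k * c) * c) = k * sqn c.
    by case: c => x y; rewrite /sqn /=; ring.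
  by rewrite !mulrA.
have := sqn_ge0 c; have := n2_ge0 g; have := n2_ge0 f.
have [g0|g0] := eqVneq (n2 g) 0.
  rewrite g0 => f0 _ c0; rewrite mulr0.
  (* When [n2 g = 0] the quadratic is affine in k, and this k gives it the value -1 unless c
     vanishes. *)
  have := key ((n2 f + 1) / (2 * sqn c)).
  have [->//|cn0] := eqVneq (sqn c) 0.
  have -> : 2 * ((n2 f + 1) / (2 * sqn c)) * sqn c = n2 f + 1 by field.
  by rewrite g0 mulr0 addr0; lra.
move=> f0 gge c0; have gpos : 0 < n2 g by rewrite lt_def g0.
have := key (n2 g)^-1.
have -> : n2 f - 2 * (n2 g)^-1 * sqn c + (n2 g)^-1 ^+ 2 * sqn c * n2 g
  = (n2 f * n2 g - sqn c) / n2 g by field.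
by rewrite pmulr_lge0 ?invr_gt0// subr_ge0.
Qed.

End ComplexIntegrals.
#[export] Hint Resolve cLinf_cst : core.
Arguments cint : simpl never.
Arguments ip : simpl never.
Arguments n2 : simpl never.
Arguments sqn : simpl never.

(** * Fourier coefficients, trigonometric polynomials and their L^2-closures *)

Section FourierCoefficients.
Variable R : realType.
Local Notation C := R[i].
Local Notation mu := (@lebesgue_measure R).
Local Notation I01 := (@I01 R).
Implicit Types (f g h : R -> C) (z w : C).

Lemma eTD (s t : R) : eT (s + t) = eT s * eT t.
Proof.
rewrite /eT mulComplex mulrDr cosD sinD; congr Complex.
by rewrite addrC.
Qed.

Lemma eT0 : eT (0 : R) = 1.
Proof. by rewrite /eT mulr0 cos0 sin0. Qed.

Lemma eT1 : eT (1 : R) = 1.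
Proof. by rewrite /eT mulr1 mulr_natl cos2pi sin2pi. Qed.

Lemma sqn_eT (t : R) : sqn (eT t) = 1.
Proof. by rewrite /sqn /eT /= cos2Dsin2. Qed.

Lemma eT_neq0 (t : R) : eT t != 0.
Proof. by rewrite -sqn_eq0 sqn_eT oner_eq0. Qed.

Lemma conj_eT (t : R) : conjc (eT t) = (eT t)^-1.
Proof.
have := sqnE (eT t); rewrite sqn_eT => h.
by apply: (mulfI (eT_neq0 t)); rewrite -h divff ?eT_neq0.
Qed.

Lemma eTN (t : R) : eT (- t) = (eT t)^-1.
Proof. by apply: (mulfI (eT_neq0 t)); rewrite -eTD subrr eT0 divff ?eT_neq0. Qed.

Lemma eT_expn (t : R) (n : nat) : eT t ^+ n = eT (n%:R * t).
Proof.
elim: n => [|n ih]; first by rewrite expr0 mul0r eT0.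
by rewrite exprS ih -eTD mulrSr; congr eT; ring.
Qed.

Lemma eT_exp (t : R) (n : int) : eT t ^ n = eT (n%:~R * t).
Proof.
case: n => n; first exact: eT_expn.
by rewrite NegzE -exprnN eT_expn -eTN rmorphN /= mulNr.
Qed.

Lemma eT_inv (t : R) : (eT t)^-1 = eT t ^ (-1).
Proof. by rewrite -eTN eT_exp rmorphN mulN1r. Qed.

Lemma conj_eT_exp (t : R) (n : int) : conjc (eT t ^ n) = eT t ^ (- n).
Proof. by rewrite eT_exp conj_eT -eTN -mulNr eT_exp rmorphN. Qed.

Lemma sqn_eT_exp (t : R) (n : int) : sqn (eT t ^ n) = 1.
Proof. by rewrite eT_exp sqn_eT. Qed.

Lemma eT_int (n : int) : eT (n%:~R : R) = 1.
Proof. by rewrite -[n%:~R]mulr1 -eT_exp eT1 exp1rz. Qed.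

Lemma continuous_cosM (k : R) : continuous (fun t : R => cos (k * t)).
Proof.
by move=> x; apply: continuous_comp; [exact: mulrl_continuous | exact: continuous_cos].
Qed.

Lemma continuous_sinM (k : R) : continuous (fun t : R => sin (k * t)).
Proof.
by move=> x; apply: continuous_comp; [exact: mulrl_continuous | exact: continuous_sin].
Qed.

Lemma int01_FTC (F f : R -> R) : continuous f ->
  (forall x : R, is_derive x 1 F (f x)) -> int01 f = F 1 - F 0.
Proof.
move=> cf dF; rewrite /int01 /Rintegral /I01.
have dF' x : derivable F x 1 by case: (dF x).
have cF x : {for x, continuous F} by apply/differentiable_continuous/derivable1_diffP.
rewrite (@continuous_FTC2 _ f F 0 1)//.
- exact: continuous_subspaceT.
- split; first by move=> x _.
  + by apply: cvg_at_right_filter; exact: cF.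
  + by apply: cvg_at_left_filter; exact: cF.
- by move=> x _; rewrite derive1E; case: (dF x).
Qed.

Lemma is_derive_scaled (F : R -> R) (k c x df : R) : is_derive (k * x) 1 F df ->
  is_derive x 1 (fun t => c * F (k * t)) (c * (df * k)).
Proof.
move=> hF; have hk : is_derive x 1 (fun t => k * t) k.
  have := @is_deriveZ R R R id k x 1 1 _.
  by rewrite /GRing.scale /= mulr1; apply.
exact: (@is_deriveZ _ _ _ (fun t => F (k * t)) c x 1 (df * k)
  (@is_derive1_comp _ F (fun t => k * t) x df k hF hk)).
Qed.

Lemma int01_cosM (k : R) : k != 0 -> int01 (fun t => cos (k * t)) = k^-1 * sin k.
Proof.
move=> k0.
have dF (x : R) : is_derive x 1 (fun t => k^-1 * sin (k * t)) (cos (k * x)).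
  have := @is_derive_scaled (@sin R) k k^-1 x _ (is_derive_sin (k * x)).
  by rewrite mulrCA mulVf// mulr1.
by rewrite (int01_FTC (@continuous_cosM k) dF) mulr1 mulr0 sin0; ring.
Qed.

Lemma int01_sinM (k : R) : k != 0 ->
  int01 (fun t => sin (k * t)) = k^-1 * (1 - cos k).
Proof.
move=> k0.
have dF (x : R) : is_derive x 1 (fun t => - k^-1 * cos (k * t)) (sin (k * x)).
  have := @is_derive_scaled (@cos R) k (- k^-1) x _ (is_derive_cos (k * x)).
  by rewrite (_ : - k^-1 * _ = sin (k * x))//; field.
by rewrite (int01_FTC (@continuous_sinM k) dF) mulr1 mulr0 cos0; ring.
Qed.

Lemma cint_eT_exp (n : int) : cint (fun t : R => eT t ^ n) = (n == 0)%:R.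
Proof.
have [->|n0] := eqVneq n 0.
  by rewrite -[RHS](@cint_cst R); apply: cint_ext => t; rewrite expr0z.
have k0 : n%:~R * (2 * pi) != 0 :> R.
  by rewrite mulf_neq0 ?intr_eq0// mulf_neq0 ?pnatr_eq0// gt_eqF// pi_gt0.
have e t : eT t ^ n = Complex (cos (n%:~R * (2 * pi) * t)) (sin (n%:~R * (2 * pi) * t)) :> C.
  by rewrite eT_exp /eT (_ : 2 * pi * (n%:~R * t) = n%:~R * (2 * pi) * t)//; ring.
have := eT_int n; rewrite /eT (_ : 2 * pi * n%:~R = n%:~R * (2 * pi)); last by ring.
move=> [c1 s0]; rewrite (cint_ext e) /cint /= int01_cosM// int01_sinM// c1 s0.
by rewrite subrr !mulr0.
Qed.

Lemma cLinf_eT_exp (n : int) : cLinf (fun t : R => eT t ^ n).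
Proof.
apply: (@cLinf_bounded _ _ 1); last by apply: ae01W => t; rewrite sqn_eT_exp.
- rewrite (_ : (fun t => _) = (fun t : R => cos ((2 * pi * n%:~R) * t))).
    apply: measurable_funTS; apply: continuous_measurable_fun; exact: continuous_cosM.
  by apply/funext => t; rewrite eT_exp /= mulrA.
- rewrite (_ : (fun t => _) = (fun t : R => sin ((2 * pi * n%:~R) * t))).
    apply: measurable_funTS; apply: continuous_measurable_fun; exact: continuous_sinM.
  by apply/funext => t; rewrite eT_exp /= mulrA.
Qed.
Hint Resolve cLinf_eT_exp : core.

(** Coefficients of a function of the parameter t. On t |-> f (eT t) this is convertible to
    [fcoef f], which ties the development to the given definitions. *)
Definition fc f (n : int) : C := cint (fun t => f t * eT t ^ (- n)).

Lemma fcE f n : fc f n = ip f (fun t => eT t ^ n).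
Proof. by apply: cint_ext => t; rewrite conj_eT_exp. Qed.

Lemma fcD f g n : cLinf f -> cLinf g ->
  fc (fun t => f t + g t) n = fc f n + fc g n.
Proof. by move=> hf hg; rewrite !fcE ipDl. Qed.

Lemma fcB f g n : cLinf f -> cLinf g ->
  fc (fun t => f t - g t) n = fc f n - fc g n.
Proof. by move=> hf hg; rewrite !fcE ipBl. Qed.

Lemma fcZ z f n : cLinf f -> fc (fun t => z * f t) n = z * fc f n.
Proof. by move=> hf; rewrite !fcE ipZl. Qed.

Lemma fc_ae_eq f g n : cLinf f -> cLinf g -> ae01 (fun t => f t = g t) ->
  fc f n = fc g n.
Proof.
move=> hf hg fg; apply: cint_ae_eq; try exact: cLinfM.
by apply: ae01_imp fg => t ->.
Qed.

Lemma fc_shift f (m n : int) : fc (fun t => eT t ^ m * f t) n = fc f (n - m).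
Proof.
apply: cint_ext => t; rewrite mulrAC mulrC -expfzDr ?eT_neq0//.
by congr (_ * _ ^ _); lia.
Qed.

Lemma fc_eT_exp (m n : int) : fc (fun t => eT t ^ m) n = (m == n)%:R.
Proof.
rewrite -[m == n]subr_eq0 -cint_eT_exp; apply: cint_ext => t.
by rewrite -expfzDr ?eT_neq0.
Qed.

Lemma fc_conj f n : cLinf f -> fc (fun t => conjc (f t)) n = conjc (fc f (- n)).
Proof.
move=> hf; rewrite /fc -cint_conj; last exact: cLinfM.
by apply: cint_ext => t; rewrite rmorphM /= conj_eT_exp opprK.
Qed.

Lemma n2_eT_exp (n : int) : n2 (fun t : R => eT t ^ n) = 1.
Proof. by rewrite -[RHS](@int01_cst R); apply: int01_ext => t; rewrite sqn_eT_exp. Qed.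

Lemma sqn_fc_le f n : cLinf f -> sqn (fc f n) <= n2 f.
Proof. by move=> hf; rewrite fcE -[leRHS]mulr1 -(n2_eT_exp n) ip_CS. Qed.

(** Trigonometric polynomials with spectrum in [S]. Terms are unordered and frequencies may repeat,
    so that sums and products are plain inductions. *)
Inductive tpoly (S : int -> Prop) : (R -> C) -> Prop :=
| tpoly0 : tpoly S (fun=> 0)
| tpoly_cons z n q : S n -> tpoly S q -> tpoly S (fun t => z * eT t ^ n + q t).

Lemma tpoly_ext S f g : (forall t, f t = g t) -> tpoly S f -> tpoly S g.
Proof. by move=> /funext ->. Qed.

Lemma tpoly_cLinf S q : tpoly S q -> cLinf q.
Proof. by elim=> [|z n p _ _ hp]//; apply: cLinfD => //; exact: cLinfM. Qed.

Lemma tpoly_sub (S S' : int -> Prop) q : (forall n, S n -> S' n) ->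
  tpoly S q -> tpoly S' q.
Proof.
move=> h; elim=> [|z n p Sn _ ih]; first exact: tpoly0.
by apply: tpoly_cons => //; exact: h.
Qed.

Lemma tpolyD S p q : tpoly S p -> tpoly S q -> tpoly S (fun t => p t + q t).
Proof.
move=> hp hq; elim: hp => [|z n p' Sn _ ih].
  by apply: tpoly_ext hq => t; rewrite add0r.
by apply: tpoly_ext (tpoly_cons z Sn ih) => t; rewrite addrA.
Qed.

Lemma tpolyZ S z q : tpoly S q -> tpoly S (fun t => z * q t).
Proof.
elim=> [|w n p Sn _ ih].
  by apply: tpoly_ext (tpoly0 S) => t; rewrite mulr0.
by apply: tpoly_ext (tpoly_cons (z * w) Sn ih) => t; rewrite mulrDr mulrA.
Qed.

Lemma tpolyN S q : tpoly S q -> tpoly S (fun t => - q t).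
Proof. by move=> /(tpolyZ (-1)); apply: tpoly_ext => t; rewrite mulN1r. Qed.

Lemma tpolyB S p q : tpoly S p -> tpoly S q -> tpoly S (fun t => p t - q t).
Proof. by move=> hp /tpolyN; exact: tpolyD. Qed.

Lemma tpoly_eT_exp (S : int -> Prop) n : S n -> tpoly S (fun t => eT t ^ n).
Proof.
move=> Sn; apply: tpoly_ext (tpoly_cons 1 Sn (tpoly0 S)) => t.
by rewrite mul1r addr0.
Qed.

Lemma tpoly_shift (S S' : int -> Prop) m q : (forall n, S n -> S' (m + n)) ->
  tpoly S q -> tpoly S' (fun t => eT t ^ m * q t).
Proof.
move=> h; elim=> [|z n p Sn _ ih].
  by apply: tpoly_ext (tpoly0 S') => t; rewrite mulr0.
apply: tpoly_ext (tpoly_cons z (h _ Sn) ih) => t.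
by rewrite expfzDr ?eT_neq0// mulrDr; ring.
Qed.

Lemma tpolyM (S S' S'' : int -> Prop) p q :
  (forall n m, S n -> S' m -> S'' (n + m)) ->
  tpoly S p -> tpoly S' q -> tpoly S'' (fun t => p t * q t).
Proof.
move=> h hp hq; elim: hp => [|z n p' Sn _ ih].
  by apply: tpoly_ext (tpoly0 S'') => t; rewrite mul0r.
have := tpolyD (tpolyZ z (tpoly_shift (h n ^~ Sn) hq)) ih.
by apply: tpoly_ext => t; rewrite mulrDl mulrA.
Qed.

Lemma tpoly_conj (S S' : int -> Prop) q : (forall n, S n -> S' (- n)) ->
  tpoly S q -> tpoly S' (fun t => conjc (q t)).
Proof.
move=> h; elim=> [|z n p Sn _ ih].
  by apply: tpoly_ext (tpoly0 S') => t; rewrite conjc0.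
apply: tpoly_ext (tpoly_cons (conjc z) (h _ Sn) ih) => t.
by rewrite rmorphD rmorphM /= conj_eT_exp.
Qed.

Lemma tpoly_ip (S : int -> Prop) f q : cLinf f -> (forall n, S n -> fc f n = 0) ->
  tpoly S q -> ip f q = 0.
Proof.
move=> hf h; elim=> [|z n p Sn hp ih].
  by rewrite -[RHS](@cint_cst R); apply: cint_ext => t; rewrite conjc0 mulr0.
rewrite ipDr//; [|exact: cLinfM|exact: tpoly_cLinf hp].
by rewrite ipZr// -fcE h// mulr0 add0r.
Qed.

Lemma tpoly_fc (S : int -> Prop) q n : tpoly S q -> ~ S n -> fc q n = 0.
Proof.
move=> hq Sn; rewrite fcE ipC//; last exact: tpoly_cLinf hq.
rewrite (tpoly_ip _ _ hq)// ?conjc0// => m Sm.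
by rewrite fc_eT_exp; case: eqP => // nm; rewrite nm in Sn.
Qed.

(** Plays the role of a Hardy space. Approximants are demanded, rather than vanishing coefficients,
    because the nonlinear Fourier series supply them directly, while recovering them from
    coefficients would need completeness of the exponentials. *)
Definition tpoly_closure (S : int -> Prop) f : Prop :=
  forall e : R, 0 < e -> exists2 q, tpoly S q & n2 (fun t => f t - q t) <= e.

Lemma le_eps (x k : R) : 0 <= k -> (forall e, 0 < e -> x <= k * e) -> x <= 0.
Proof.
move=> k0 h; rewrite leNgt; apply/negP => x0.
have := h (x / (2 * (k + 1))); rewrite divr_gt0//; last by lra.
move=> /(_ isT); rewrite mulrA ler_pdivlMr; last by lra.
by nra.
Qed.

(** [f] is orthogonal to each approximant of [g], and Cauchy-Schwarz bounds the rest. This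
    orthogonality is the substitute for Parseval's identity. *)
Lemma cl_ip (S : int -> Prop) f g : cLinf f -> cLinf g ->
  (forall n, S n -> fc f n = 0) -> tpoly_closure S g -> ip f g = 0.
Proof.
move=> hf hg h clg; apply/eqP; rewrite -sqn_eq0 eq_le sqn_ge0 andbT.
apply: (le_eps (n2_ge0 f)) => e e0; have [q hq gq] := clg _ e0.
have cq := tpoly_cLinf hq.
rewrite -[ip f g]subr0 -(tpoly_ip hf h hq) -ipBr//.
apply: le_trans (ip_CS hf (cLinfB hg cq)) _.
by rewrite ler_wpM2l// n2_ge0.
Qed.

Lemma cl_fc (S : int -> Prop) f n : cLinf f -> tpoly_closure S f -> ~ S n -> fc f n = 0.
Proof.
move=> hf clf Sn; rewrite fcE ipC// (cl_ip _ _ _ clf)// ?conjc0// => m Sm.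
by rewrite fc_eT_exp; case: eqP => // nm; rewrite nm in Sn.
Qed.

Lemma clB S f g : cLinf f -> cLinf g -> tpoly_closure S f -> tpoly_closure S g ->
  tpoly_closure S (fun t => f t - g t).
Proof.
move=> hf hg clf clg e e0; have e4 : 0 < e / 4 by lra.
have [[p hp fp] [q hq gq]] := (clf _ e4, clg _ e4).
exists (fun t => p t - q t); first exact: tpolyB.
have [cp cq] := (tpoly_cLinf hp, tpoly_cLinf hq).
rewrite (_ : (fun t => _) = (fun t => (f t - p t) + - (g t - q t))); last first.
  by apply/funext => t; ring.
apply: le_trans (n2D_le (cLinfB hf cp) (cLinfN (cLinfB hg cq))) _.
by rewrite n2N; lra.
Qed.

Lemma clZ S z f : cLinf f -> tpoly_closure S f -> tpoly_closure S (fun t => z * f t).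
Proof.
move=> hf clf e e0; have s0 := sqn_ge0 z.
have [|p hp fp] := clf (e / (sqn z + 1)); first by rewrite divr_gt0//; lra.
exists (fun t => z * p t); first exact: tpolyZ.
rewrite (_ : (fun t => _) = (fun t => z * (f t - p t))); last first.
  by apply/funext => t; ring.
rewrite n2Z; last exact/cLinfB/tpoly_cLinf/hp.
apply: le_trans (ler_wpM2l s0 fp) _.
by rewrite mulrA ler_pdivrMr; [nra|lra].
Qed.

Lemma cl_conj (S S' : int -> Prop) f : (forall n, S n -> S' (- n)) ->
  tpoly_closure S f -> tpoly_closure S' (fun t => conjc (f t)).
Proof.
move=> h clf e e0; have [p hp fp] := clf _ e0.
exists (fun t => conjc (p t)); first exact: tpoly_conj hp.
rewrite (_ : (fun t => _) = (fun t => conjc (f t - p t))) ?n2_conj//.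
by apply/funext => t; rewrite rmorphB.
Qed.

End FourierCoefficients.
#[export] Hint Resolve cLinf_eT_exp : core.
Arguments fc : simpl never.

(** * Finite nonlinear Fourier series: spectra, normalisation and the coefficient F_0 *)

Section Windows.
Variable R : realType.
Local Notation C := R[i].
Implicit Types (F : int -> C) (f g : R -> C) (t : R).

(** L^2-approximation does not pass to products by itself. In fg - pq = f (g - q) + (f - p) q each
    term has one factor bounded by 1, which is why a bound is asked of [f] and of [q]. *)
Lemma cl_mul (S S' S'' : int -> Prop) f g p q (e : R) :
  (forall n m, S n -> S' m -> S'' (n + m)) ->
  cLinf f -> cLinf g -> tpoly S p -> tpoly S' q ->
  ae01 (fun t => sqn (f t) <= 1) -> (forall t, sqn (q t) <= 1) ->
  n2 (fun t => f t - p t) <= e -> n2 (fun t => g t - q t) <= e ->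
  tpoly S'' (fun t => p t * q t) /\
  n2 (fun t => f t * g t - p t * q t) <= 4 * e.
Proof.
move=> h hf hg hp hq f1 q1 fp gq; split; first exact: tpolyM hp hq.
have [cp cq] := (tpoly_cLinf hp, tpoly_cLinf hq).
have [cfp cgq] := (cLinfB hf cp, cLinfB hg cq).
rewrite (_ : (fun t => _) = (fun t => f t * (g t - q t) + (f t - p t) * q t)); last first.
  by apply/funext => t; ring.
apply: le_trans (n2D_le (cLinfM hf cgq) (cLinfM cfp cq)) _.
have l1 : n2 (fun t => f t * (g t - q t)) <= n2 (fun t => g t - q t).
  apply: n2_le => //; first exact: cLinfM.
  by apply: ae01_imp f1 => t ft; rewrite sqnM ler_piMl ?sqn_ge0.
have l2 : n2 (fun t => (f t - p t) * q t) <= n2 (fun t => f t - p t).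
  apply: n2_le => //; first exact: cLinfM.
  by apply: ae01W => t; rewrite sqnM ler_piMr ?sqn_ge0.
by lra.
Qed.

(** Both f and the conjugate of g have no positive frequencies, so the mean of their product is the
    product of their means. Subtracting the mean from f reduces this to [cl_ip]. *)
Lemma ip_analytic f g : cLinf f -> cLinf g -> (forall n : int, 0 < n -> fc f n = 0) ->
  tpoly_closure (fun n => 0 <= n) g -> ip f g = fc f 0 * conjc (fc g 0).
Proof.
move=> hf hg f0 clg; set c := fc f 0.
have fc1 n : fc (fun=> c) n = if n == 0 then c else 0.
  rewrite -[fun=> c](_ : (fun t => c * eT t ^ 0) = _); last first.
    by apply/funext => t; rewrite expr0z mulr1.
  rewrite fcZ; last exact: cLinf_eT_exp.
  by rewrite fc_eT_exp eq_sym; case: ifP; rewrite ?mulr1 ?mulr0.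
have : ip (fun t => f t - c) g = 0.
  apply: cl_ip clg => //; first exact: cLinfB.
  move=> n; rewrite le_eqVlt => /predU1P[<-|n0].
    by rewrite fcB// fc1 eqxx subrr.
  by rewrite fcB// fc1 f0// gt_eqF// subrr.
rewrite ipBl// => /eqP; rewrite subr_eq0 => /eqP ->.
rewrite -[fun=> c](_ : (fun t => c * eT t ^ 0) = _); last first.
  by apply/funext => t; rewrite expr0z mulr1.
have he := @cLinf_eT_exp R 0.
by rewrite ipZl// (ipC hg he) -fcE.
Qed.

Definition window_mx F (m : int) (N : nat) t : 'M[C]_2 :=
  \prod_(i < N) nlft_factor (F (m + i%:Z)) (m + i%:Z) (eT t).

Lemma window_mxS F m N t :
  window_mx F m N.+1 t = nlft_factor (F m) m (eT t) * window_mx F (m + 1) N t.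
Proof.
rewrite /window_mx big_ord_recl /= addr0; congr (_ * _).
apply: eq_bigr => i _; rewrite /bump /= add1n.
by have -> : m + (i.+1)%:Z = m + 1 + i%:Z by lia.
Qed.

Definition wnorm F (m : int) : C := toC (Num.sqrt (1 + cabs (F m) ^+ 2))^-1.

Lemma conj_wnorm F m : conjc (wnorm F m) = wnorm F m.
Proof. by rewrite /wnorm /toC /= oppr0. Qed.

Lemma sqn_wnorm F m : sqn (wnorm F m) * (1 + sqn (F m)) = 1.
Proof.
have h := sqn_ge0 (F m); rewrite sqn_toC sqr_cabs exprVn sqr_sqrtr; last by lra.
by rewrite mulVf// gt_eqF//; lra.
Qed.

Lemma mul_row2 (A B : 'M[C]_2) i j : (A * B) i j = A i 0 * B 0 j + A i 1 * B 1 j.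
Proof.
rewrite [A * B]/(A *m B) mxE !big_ord_recl big_ord0 addr0.
by rewrite (_ : lift ord0 ord0 = 1 :> 'I_2) //; apply/val_inj.
Qed.

Lemma factor_entries F m t (M := nlft_factor (F m) m (eT t)) :
  [/\ M 0 0 = wnorm F m, M 0 1 = wnorm F m * (F m * eT t ^ m),
      M 1 0 = - (wnorm F m * (conjc (F m) * eT t ^ (- m))) & M 1 1 = wnorm F m].
Proof.
by rewrite /M /nlft_factor; split; rewrite !mxE /= ?mulr1 ?mulrN ?cconjE.
Qed.

(** All factors lie in SU(2), a group whose elements are determined by their first row; the
    recursion can therefore be run on (a, b) alone. *)
Lemma window_su2 F m N t (M := window_mx F m N t) :
  M 1 0 = - conjc (M 0 1) /\ M 1 1 = conjc (M 0 0).
Proof.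
rewrite {}/M; elim: N m => [|N ih] m.
  by rewrite /window_mx big_ord0 !mxE; split; apply/eqP; rewrite eq_complex /= ?opprK ?oppr0 ?eqxx.
have [e1 e2] := ih (m + 1); have [f1 f2 f3 f4] := factor_entries F m t.
rewrite window_mxS !mul_row2 f1 f2 f3 f4 e1 e2.
rewrite !(conjcD, conjcM, conjcN) !conjcK conj_wnorm conj_eT_exp.
by split; ring.
Qed.

Definition win_a F m N t : C := window_mx F m N t 0 0.
Definition win_b F m N t : C := window_mx F m N t 0 1.

Lemma win_aS F m N t : win_a F m N.+1 t =
  wnorm F m * (win_a F (m + 1) N t - F m * (eT t ^ m * conjc (win_b F (m + 1) N t))).
Proof.
have [e1 _] := window_su2 F (m + 1) N t; have [f1 f2 _ _] := factor_entries F m t.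
by rewrite /win_a window_mxS mul_row2 f1 f2 e1 /win_b; ring.
Qed.

Lemma win_bS F m N t : win_b F m N.+1 t =
  wnorm F m * (win_b F (m + 1) N t + F m * (eT t ^ m * conjc (win_a F (m + 1) N t))).
Proof.
have [_ e2] := window_su2 F (m + 1) N t; have [f1 f2 _ _] := factor_entries F m t.
by rewrite /win_b window_mxS mul_row2 f1 f2 e2 /win_a; ring.
Qed.

Lemma sqn_sum_id (w z x y e : C) : sqn e = 1 ->
  sqn (w * (x - z * (e * conjc y))) + sqn (w * (y + z * (e * conjc x)))
  = sqn w * (1 + sqn z) * (sqn x + sqn y).
Proof.
(* Putting [sqn e] back turns the claim into a polynomial identity. *)
move=> e1; have -> : sqn w * (1 + sqn z) * (sqn x + sqn y) =
  sqn w * (1 + sqn e * sqn z) * (sqn x + sqn y) by rewrite e1 mul1r.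
case: w z x y e {e1} => [w1 w2] [z1 z2] [x1 x2] [y1 y2] [e1 e2].
by rewrite /sqn /=; ring.
Qed.

Lemma win_sqn F m N t : sqn (win_a F m N t) + sqn (win_b F m N t) = 1.
Proof.
elim: N m => [|N ih] m.
  by rewrite /win_a /win_b /window_mx big_ord0 !mxE /= sqn0 sqn1 addr0.
by rewrite win_aS win_bS sqn_sum_id ?sqn_eT_exp// sqn_wnorm ih mulr1.
Qed.

Lemma win_sqn_le1 F m N t : sqn (win_a F m N t) <= 1 /\ sqn (win_b F m N t) <= 1.
Proof.
have := win_sqn F m N t; have := sqn_ge0 (win_a F m N t).
by have := sqn_ge0 (win_b F m N t); split; lra.
Qed.

(** The lower bound on the spectrum of a is what yields, in the induction, the upper bound on that
    of b; through it a window ending at -1 has a b with negative frequencies only. The case [n = 0]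
    is separate for the empty window, where a = 1. *)
Lemma win_tpoly F m (N : nat) :
  tpoly (fun n => n <= 0 /\ (n = 0 \/ - N%:Z < n)) (win_a F m N) /\
  tpoly (fun n => m <= n < m + N%:Z) (win_b F m N).
Proof.
elim: N m => [|N ih] m.
  split.
    apply: (@tpoly_ext _ _ (fun t => eT t ^ 0)).
      by move=> t; rewrite /win_a /window_mx big_ord0 !mxE expr0z.
    by apply: tpoly_eT_exp; split=> //; left.
  apply: (@tpoly_ext _ _ (fun=> 0)); last exact: tpoly0.
  by move=> t; rewrite /win_b /window_mx big_ord0 !mxE.
have [ha hb] := ih (m + 1); split.
- rewrite (funext (win_aS F m N)); apply/tpolyZ/tpolyB.
    by apply: tpoly_sub ha => n; lia.
  apply: tpolyZ; apply: (@tpoly_shift _ (fun n => m + 1 <= - n < m + 1 + N%:Z)).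
    by move=> n; lia.
  by apply: tpoly_conj hb => n; lia.
- rewrite (funext (win_bS F m N)); apply/tpolyZ/tpolyD.
    by apply: tpoly_sub hb => n; lia.
  apply: tpolyZ; apply: (@tpoly_shift _ (fun n => 0 <= n /\ (n = 0 \/ n < N%:Z))).
    by move=> n; lia.
  by apply: tpoly_conj ha => n; lia.
Qed.

(** Strip off the factor of index 0: the b of the remaining window starts at frequency 1 and
    contributes to neither zeroth coefficient. In the limit this identity recovers F_0 from the
    right factor. *)
Lemma win_fc0 F N : fc (win_b F 0 N.+1) 0 = F 0 * conjc (fc (win_a F 0 N.+1) 0).
Proof.
have eb t : win_b F 0 N.+1 t =
    wnorm F 0 * (win_b F 1 N t + F 0 * conjc (win_a F 1 N t)).
  by rewrite win_bS expr0z mul1r.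
have ea t : win_a F 0 N.+1 t =
    wnorm F 0 * (win_a F 1 N t - F 0 * conjc (win_b F 1 N t)).
  by rewrite win_aS expr0z mul1r.
rewrite (funext eb) (funext ea).
have [ha hb] := win_tpoly F 1 N.
have [ca cb] := (tpoly_cLinf ha, tpoly_cLinf hb).
have [cca ccb] := (cLinf_conj ca, cLinf_conj cb).
have [cfa cfb] := (cLinfM (cLinf_cst (F 0)) cca, cLinfM (cLinf_cst (F 0)) ccb).
have [cA cB] := (cLinfB ca cfb, cLinfD cb cfa).
rewrite !fcZ// fcD// fcB// !fcZ// !fc_conj// oppr0.
rewrite (tpoly_fc hb) ?conjc0; last by lia.
by rewrite mulr0 subr0 add0r conjcM conj_wnorm; ring.
Qed.

End Windows.

(** * Division by zero-free polynomials in 1/z, and Abel means *)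

Section Division.
Variable R : realType.
Local Notation C := R[i].
Implicit Types (f g u : R -> C) (t : R) (z w r : C).

Lemma cabs_ge0 z : 0 <= cabs z. Proof. exact: sqrtr_ge0. Qed.

Lemma cabsD z w : cabs (z + w) <= cabs z + cabs w.
Proof.
have normcE' (x : C) : cabs x = ComplexField.Normc.normc x by case: x.
by rewrite !normcE'; exact: le_normcD.
Qed.

Lemma cabsN z : cabs (- z) = cabs z.
Proof. by rewrite !cabsE sqnN. Qed.

Lemma cabsB_ge z w : cabs z - cabs w <= cabs (z - w).
Proof. by rewrite lerBlDr -[X in cabs X <= _](subrK w) cabsD. Qed.

Lemma le_cabs_sqn (x : R) z : 0 <= x -> (x <= cabs z) = (x ^+ 2 <= sqn z).
Proof.
move=> x0; rewrite -sqr_cabs ler_sqr// nnegrE//; exact: cabs_ge0.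
Qed.

Lemma cabs_le_sqn (x : R) z : 0 <= x -> (cabs z <= x) = (sqn z <= x ^+ 2).
Proof.
move=> x0; rewrite -sqr_cabs ler_sqr// nnegrE//; exact: cabs_ge0.
Qed.

Lemma quarter_bound (x y e : R) : x <= e / 4 -> y <= e / 4 -> 2 * (x + y) <= e.
Proof. by lra. Qed.

Lemma bernoulli_le (x : R) (n : nat) : 0 <= x -> 1 + n%:R * x <= (1 + x) ^+ n.
Proof.
move=> x0; elim: n => [|n ih]; first by rewrite mul0r addr0 expr0.
rewrite exprS; apply: le_trans (ler_wpM2l _ ih); last by lra.
have n0 : 0 <= n%:R :> R by rewrite ler0n.
by rewrite -natr1; nra.
Qed.

Lemma bernoulli_sub (s : R) (n : nat) : 0 <= s <= 1 -> 1 - s ^+ n <= n%:R * (1 - s).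
Proof.
move=> /andP[s0 s1]; elim: n => [|n ih]; first by rewrite mul0r expr0 subrr.
have /andP[p0 p1] : 0 <= s ^+ n <= 1 by rewrite exprn_ge0//= exprn_ile1.
by rewrite exprS -natr1; nra.
Qed.

(* Since u = (1/z - r) v, the coefficients of v satisfy a geometric recursion
   with ratio r, |r| > 1, which is only compatible with boundedness when they
   vanish. *)
Lemma fc_div_linear u r (v := fun t => u t / ((eT t)^-1 - r)) : cLinf u ->
  1 < sqn r -> (forall n : int, 0 < n -> fc u n = 0) ->
  [/\ cLinf v, forall n : int, 0 < n -> fc v n = 0 & fc v 0 * - r = fc u 0].
Proof.
move=> hu r1 u0.
have cr1 : 1 < cabs r by rewrite cabsE -[1 in ltLHS]sqrtr1 ltr_sqrt//; lra.
have low t : (cabs r - 1) ^+ 2 <= sqn ((eT t)^-1 - r).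
  rewrite -le_cabs_sqn; last by lra.
  have := cabsB_ge r (eT t)^-1; rewrite -(cabsN (r - _)) opprB.
  by rewrite [cabs (eT t)^-1]cabsE sqnV sqn_eT invr1 sqrtr1.
have pos : 0 < (cabs r - 1) ^+ 2 by rewrite exprn_gt0// subr_gt0.
have cE : cLinf (fun t => (eT t)^-1 - r).
  by apply: cLinfB => //; apply: cLinf_ext (@cLinf_eT_exp R (-1)) => t; rewrite eT_inv.
have cv : cLinf v.
  by apply: cLinfM => //; apply: cLinf_inv pos _ cE; exact: ae01W.
have rec n : fc u n = fc v (n + 1) - r * fc v n.
  have -> : fc u n = fc (fun t => eT t ^ (-1) * v t - r * v t) n.
    congr fc; apply/funext => t; rewrite -mulrBl -eT_inv /v mulrCA divff ?mulr1//.
    by rewrite -sqn_eq0 gt_eqF// (lt_le_trans pos).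
  rewrite fcB ?fcZ ?fc_shift ?opprK//; [exact: cLinfM|exact: cLinfM].
have v0 (n : int) : 0 < n -> fc v n = 0.
  move=> n0; apply/eqP; rewrite -sqn_eq0 eq_le sqn_ge0 andbT.
  have vk (k : nat) : fc v (n + k%:Z) = r ^+ k * fc v n.
    elim: k => [|k ih]; first by rewrite addr0 mul1r.
    have := rec (n + k%:Z); rewrite u0; last by lia.
    move=> /esym/eqP; rewrite subr_eq0 => /eqP.
    by rewrite -addrA -[k%:Z + 1]/((k%:Z + 1%:Z)) -PoszD addn1 => ->; rewrite ih exprS mulrA.
  have sqX (k : nat) : sqn (r ^+ k) = sqn r ^+ k.
    by elim: k => [|k ih]; rewrite ?sqn1// !exprS sqnM ih.
  rewrite leNgt; apply/negP => vpos.
  set x := sqn r - 1; have x0 : 0 < x by rewrite subr_gt0.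
  have xv0 : 0 < x * sqn (fc v n) by exact: mulr_gt0.
  (* After k steps, Bernoulli's inequality makes the coefficient too large for the bound [n2 v]. *)
  pose k := Num.bound (n2 v / (x * sqn (fc v n))).
  have kb : n2 v < k%:R * (x * sqn (fc v n)).
    rewrite -ltr_pdivrMr// /k; apply: le_lt_trans (archi_boundP _) => //.
    by rewrite divr_ge0 ?n2_ge0// ltW.
  have := sqn_fc_le (n + k%:Z) cv; rewrite vk sqnM sqX.
  have := bernoulli_le k (ltW x0); rewrite (_ : 1 + x = sqn r); last by rewrite /x; ring.
  move=> hb.
  apply/negP; rewrite -ltNge; apply: lt_le_trans kb _.
  rewrite mulrA; apply: ler_wpM2r; first exact: sqn_ge0.
  by apply: le_trans hb; rewrite lerDr ler01.
split => //; rewrite rec add0r (v0 1)// sub0r mulrN mulrC//.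
Qed.

(** The last conclusion is multiplicativity of the value at infinity: [0 - r] is the linear factor
    at w = 1/z = 0. *)
Lemma fc_div_prod u (rs : seq C)
    (v := fun t => u t / \prod_(r <- rs) ((eT t)^-1 - r)) :
  cLinf u -> all (fun r => 1 < sqn r) rs -> (forall n : int, 0 < n -> fc u n = 0) ->
  [/\ cLinf v, forall n : int, 0 < n -> fc v n = 0
    & fc v 0 * \prod_(r <- rs) (0 - r) = fc u 0].
Proof.
rewrite {}/v; elim: rs u => [|r rs ih] u hu /=.
  move=> _ u0; have -> : (fun t => u t / \prod_(r <- [::]) ((eT t)^-1 - r)) = u.
    by apply/funext => t; rewrite big_nil invr1 mulr1.
  by split => //; rewrite big_nil mulr1.
move=> /andP[r1 rs1] u0; have [cv v0 ve] := fc_div_linear hu r1 u0.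
have [cw w0 we] := ih _ cv rs1 v0.
have e : (fun t => u t / \prod_(i <- r :: rs) ((eT t)^-1 - i)) =
  (fun t => u t / ((eT t)^-1 - r) / \prod_(i <- rs) ((eT t)^-1 - i)).
  by apply/funext => t; rewrite big_cons invfM mulrA.
rewrite e; split => //.
by rewrite big_cons mulrCA we mulrC sub0r.
Qed.

Lemma fc_div_poly u (P : {poly C}) (v := fun t => u t / P.[(eT t)^-1]) : cLinf u ->
  (forall n : int, 0 < n -> fc u n = 0) ->
  (forall w, sqn w <= 1 -> P.[w] != 0) ->
  [/\ cLinf v, forall n : int, 0 < n -> fc v n = 0 & fc v 0 * P.[0] = fc u 0].
Proof.
move=> hu u0 Pn0; have [rs Prs] := closed_field_poly_normal P.
have l0 : lead_coef P != 0.
  rewrite lead_coef_eq0; apply/eqP => P0.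
  by have := Pn0 0; rewrite sqn0 ler01 P0 horner0 eqxx => /(_ isT).
have Pe w : P.[w] = lead_coef P * \prod_(r <- rs) (w - r).
  rewrite Prs hornerZ horner_prod lead_coefZ.
  have /monicP -> : \prod_(z <- rs) ('X - z%:P) \is monic by exact: monic_prod_XsubC.
  by rewrite mulr1; congr (_ * _); apply: eq_bigr => r _; rewrite hornerXsubC.
have rs1 : all (fun r => 1 < sqn r) rs.
  apply/allP => r rrs; rewrite ltNge; apply/negP => /Pn0 /eqP; apply.
  by rewrite Pe (big_rem r)//= subrr mul0r mulr0.
have hu' : cLinf (fun t => (lead_coef P)^-1 * u t) by exact: cLinfM.
have u0' (n : int) : 0 < n -> fc (fun t => (lead_coef P)^-1 * u t) n = 0.
  by move=> n0; rewrite fcZ// u0// mulr0.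
have [cw w0 we] := fc_div_prod hu' rs1 u0'.
have e : v = fun t => (lead_coef P)^-1 * u t / \prod_(r <- rs) ((eT t)^-1 - r).
  by apply/funext => t; rewrite /v Pe invfM; ring.
rewrite e; split => //.
by rewrite Pe mulrCA we fcZ// mulrA divff// mul1r.
Qed.

(** Truncated Abel mean in the variable w = 1/z. Up to truncation its value at w is the analytic
    extension at 1 / (s w), a point strictly outside the closed disc when |w| <= 1 and 0 < s < 1. *)
Definition abel (s : R) (N : nat) f : {poly C} :=
  \poly_(n < N) (toC (s ^+ n) * fc f (- n%:Z)).

Definition abelT s N f t : C := (abel s N f).[(eT t)^-1].

Lemma abelTE s N f t : abelT s N f t =
  \sum_(n < N) (toC (s ^+ n) * fc f (- n%:Z)) * eT t ^ (- n%:Z).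
Proof.
rewrite /abelT horner_poly; apply: eq_bigr => n _.
by rewrite -exprnN exprVn.
Qed.

Lemma abelT_cLinf s N f : cLinf (abelT s N f).
Proof.
rewrite (funext (abelTE s N f)); apply: cLinf_sum => i.
exact: cLinfM.
Qed.

(** [K] is separated from [N] so that the spectrum stays fixed during the induction. *)
Lemma tpoly_sum_eT (c : nat -> C) K N : (N <= K)%N ->
  tpoly (fun n => - K%:Z < n) (fun t => \sum_(n < N) c n * eT t ^ (- n%:Z)).
Proof.
elim: N => [|N ih] NK.
  by apply: tpoly_ext (tpoly0 _ _) => t; rewrite big_ord0.
have SN : - K%:Z < - N%:Z by lia.
apply: tpoly_ext (tpoly_cons (c N) SN (ih (ltnW NK))) => t.
by rewrite big_ord_recr addrC.
Qed.

Lemma n2_sum_eT (c : nat -> C) N :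
  n2 (fun t => \sum_(n < N) c n * eT t ^ (- n%:Z)) = \sum_(n < N) sqn (c n).
Proof.
elim: N => [|N ih].
  rewrite big_ord0 -[RHS](@int01_cst R); apply: int01_ext => t.
  by rewrite big_ord0 sqn0.
pose q t := \sum_(n < N) c n * eT t ^ (- n%:Z).
have cq : cLinf q by apply: cLinf_sum => i; exact: cLinfM.
have hq : tpoly (fun n => - N%:Z < n) q by exact: tpoly_sum_eT.
(* The sign lets the sum be read as a difference, the form treated by [n2B_expand]. *)
pose h t := - c N * eT t ^ (- N%:Z).
have ch : cLinf h by exact: cLinfM.
rewrite big_ord_recr /= -ih.
rewrite (_ : (fun t => _) = (fun t => q t - h t)); last first.
  by apply/funext => t; rewrite big_ord_recr /h mulNr opprK.
rewrite n2B_expand//.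
have -> : ip q h = 0.
  rewrite ipZr// -fcE (tpoly_fc hq) ?mulr0//; lia.
rewrite /h n2Z// n2_eT_exp sqnN; rewrite /=; ring.
Qed.

Lemma bessel N f : cLinf f -> \sum_(n < N) sqn (fc f (- n%:Z)) <= n2 f.
Proof.
move=> hf; pose q t := \sum_(n < N) fc f (- n%:Z) * eT t ^ (- n%:Z).
have cq : cLinf q by apply: cLinf_sum => i; exact: cLinfM.
have e : complex.Re (ip f q) = \sum_(n < N) sqn (fc f (- n%:Z)).
  rewrite /q {cq q}; elim: N => [|N ih].
    rewrite big_ord0 (_ : ip _ _ = 0)//; rewrite -[RHS](@cint_cst R).
    by apply: cint_ext => t; rewrite big_ord0 conjc0 mulr0.
  rewrite (_ : (fun t => _) = (fun t => \sum_(n < N) fc f (- n%:Z) * eT t ^ (- n%:Z)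
    + fc f (- N%:Z) * eT t ^ (- N%:Z))); last first.
    by apply/funext => t; rewrite big_ord_recr.
  rewrite ipDr//; [|by apply: cLinf_sum => i; exact: cLinfM|exact: cLinfM].
  have eN : ip f (fun t => fc f (- N%:Z) * eT t ^ (- N%:Z)) = toC (sqn (fc f (- N%:Z))).
    by rewrite ipZr// -fcE mulrC -sqnE.
  by rewrite big_ord_recr -ih eN; case: (ip _ _).
have := n2_ge0 (fun t => f t - q t); rewrite n2B_expand// e.
by rewrite /q (n2_sum_eT (fun n => fc f (- n%:Z))); lra.
Qed.

(** Bessel's inequality with damping factors at most 1. Uniformity in [s] and [N] is what extends
    convergence of Abel means from polynomials to their closure. *)
Lemma n2_abelT s N f : 0 <= s <= 1 -> cLinf f -> n2 (abelT s N f) <= n2 f.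
Proof.
move=> /andP[s0 s1] hf; apply: le_trans (bessel N hf).
rewrite (funext (abelTE s N f)).
rewrite (n2_sum_eT (fun n => toC (s ^+ n) * fc f (- n%:Z))).
apply: ler_sum => n _; rewrite sqnM sqn_toC ler_piMl ?sqn_ge0//.
by rewrite -exprM exprn_ile1.
Qed.

Lemma abelTB s N f g t : cLinf f -> cLinf g ->
  abelT s N (fun t => f t - g t) t = abelT s N f t - abelT s N g t.
Proof.
move=> hf hg; rewrite !abelTE -sumrB; apply: eq_bigr => n _.
by rewrite fcB//; ring.
Qed.

Lemma abelT_eT s N (z : C) (k : nat) t : (k < N)%N ->
  abelT s N (fun t => z * eT t ^ (- k%:Z)) t = toC (s ^+ k) * (z * eT t ^ (- k%:Z)).
Proof.
move=> kN; rewrite abelTE (bigD1 (Ordinal kN))//= big1 ?addr0.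
  by rewrite fcZ// fc_eT_exp eqxx mulr1; ring.
move=> i ik; rewrite fcZ// fc_eT_exp.
rewrite (_ : (- k%:Z == - i%:Z) = false); first by rewrite !mulr0 mul0r.
by apply/negbTE; move: ik; apply: contra => /eqP h; apply/eqP/val_inj => /=; lia.
Qed.

Lemma abelT_tpoly q : tpoly (fun n => n <= 0) q -> forall e : R, 0 < e ->
  exists2 h : R, 0 < h & forall s, 1 - h <= s <= 1 -> 0 <= s ->
    exists N0 : nat, forall N : nat, (N0 <= N)%N ->
      n2 (fun t => q t - abelT s N q t) <= e.
Proof.
elim=> [|z n p n0 hp ih] e e0.
  exists 1 => // s _ _; exists 0%N => N _.
  rewrite (_ : n2 _ = 0) ?ltW// -[RHS](@int01_cst R); apply: int01_ext => t.
  rewrite abelTE big1 ?subrr ?sqn0// => i _.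
  by rewrite (tpoly_fc (tpoly0 R (fun=> False)))// mulr0 mul0r.
have e4 : 0 < e / 4 by lra.
have [h h0 H] := ih _ e4.
have [k nk] : exists k : nat, n = - k%:Z by exists `|n|%N; lia.
(* The monomial has squared error |z|^2 (1 - s^k)^2 <= |z|^2 k^2 (1 - s), to be at most e / 4; the
   summand 1 keeps the denominator positive. *)
pose d := e / 4 / (sqn z * k%:R ^+ 2 + 1).
have K0 : 0 <= sqn z * k%:R ^+ 2 by rewrite mulr_ge0 ?sqn_ge0// sqr_ge0.
have d0 : 0 < d by rewrite divr_gt0//; lra.
exists (Num.min h d); first by rewrite lt_min h0.
move=> s /andP[sh s1] s0.
have [hs ds] : h >= 1 - s /\ d >= 1 - s.
  by have : 1 - s <= Num.min h d by [lra]; rewrite le_min => /andP[].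
have [||N0 HN] := H s; [by apply/andP; split; lra | by [] |].
exists (maxn N0 k.+1) => N; rewrite geq_max => /andP[N0N kN].
pose E t := z * eT t ^ n.
have cE : cLinf E by exact: cLinfM.
have cp := tpoly_cLinf hp.
have cpA := cLinfB cp (abelT_cLinf s N p).
have cEA := cLinfB cE (abelT_cLinf s N E).
rewrite (_ : (fun t => _) = (fun t => (E t - abelT s N E t) + (p t - abelT s N p t))); last first.
  (* The sum is rewritten as E - (- p) because [abelTB] treats differences. *)
  apply/funext => t; rewrite -[p]opprK.
  have -> : abelT s N (fun t => z * eT t ^ n + (- (- p)) t) t =
     abelT s N (fun t => E t - (- p t)) t by congr abelT; apply/funext.
  have -> : (- - p) = p by rewrite opprK.
  rewrite abelTB//; last exact: cLinfN.
  have -> : abelT s N (fun t => - p t) t = - abelT s N p t.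
    rewrite !abelTE -sumrN; apply: eq_bigr => i _.
    rewrite (_ : (fun t => - p t) = (fun t => (-1) * p t)) ?fcZ//; first by ring.
    by apply/funext => x; rewrite mulN1r.
  by rewrite /E; ring.
apply: le_trans (n2D_le cEA cpA) _.
apply: quarter_bound (HN _ N0N).
rewrite (_ : (fun t => _) = (fun t => (toC (1 - s ^+ k) * z) * eT t ^ n)); last first.
  apply/funext => t; rewrite /E nk abelT_eT//.
  have -> : toC (1 - s ^+ k) = 1 - toC (s ^+ k).
    by rewrite /toC; apply/eqP; rewrite eq_complex /= subrr !eqxx.
  by ring.
rewrite n2Z// n2_eT_exp mulr1 sqnM sqn_toC.
have sk : 0 <= 1 - s ^+ k <= k%:R * (1 - s).
  by rewrite subr_ge0 exprn_ile1//= bernoulli_sub// s0.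
have hk : (1 - s ^+ k) ^+ 2 <= k%:R ^+ 2 * (1 - s).
  apply: (@le_trans _ _ ((k%:R * (1 - s)) ^+ 2)).
    by rewrite ler_sqr ?nnegrE; case/andP: sk => // *; lra.
  by rewrite exprMn ler_wpM2l ?sqr_ge0//; nra.
apply: (@le_trans _ _ (sqn z * k%:R ^+ 2 * d)).
  rewrite mulrC -mulrA; apply: ler_wpM2l; first exact: sqn_ge0.
  by apply: le_trans hk _; rewrite ler_wpM2l ?sqr_ge0.
by rewrite /d mulrA ler_pdivrMr; [nra | lra].
Qed.

Lemma abelT_cl f : cLinf f -> tpoly_closure (fun n => n <= 0) f -> forall e : R, 0 < e ->
  exists2 h : R, 0 < h & forall s, 1 - h <= s <= 1 -> 0 <= s ->
    exists N0 : nat, forall N : nat, (N0 <= N)%N ->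
      n2 (fun t => f t - abelT s N f t) <= e.
Proof.
(* The error splits into f - q, q minus its Abel mean, and the Abel mean of f - q; two nested uses
   of [n2D_le] cost a factor 4 each. *)
move=> hf clf e e0; have e8 : 0 < e / 16 by lra.
have [q hq fq] := clf _ e8; have cq := tpoly_cLinf hq.
have [h h0 H] := abelT_tpoly hq e8.
exists h => // s sh s0; have [N0 HN] := H s sh s0; exists N0 => N N0N.
have cfq := cLinfB hf cq.
have cA := abelT_cLinf s N (fun t => f t - q t).
have cqA := cLinfB cq (abelT_cLinf s N q).
rewrite (_ : (fun t => _) = (fun t => ((f t - q t) + (q t - abelT s N q t))
    + - abelT s N (fun t => f t - q t) t)); last first.
  by apply/funext => t; rewrite abelTB//; ring.
apply: le_trans (n2D_le (cLinfD cfq cqA) (cLinfN cA)) _; rewrite n2N.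
have /andP[_ s1] := sh; have s01 : 0 <= s <= 1 by rewrite s0.
have e84 : e / 16 <= e / 4 by lra.
apply: quarter_bound; last exact: le_trans (n2_abelT N s01 cfq) (le_trans fq e84).
apply: le_trans (n2D_le cfq cqA) _.
by apply: quarter_bound; [move: fq | have := HN _ N0N];
  rewrite (_ : e / 4 / 4 = e / 16)//; lra.
Qed.

End Division.

(** * Zero-free approximation of a, and division by a *)

Section Outer.
Variable R : realType.
Local Notation C := R[i].
Implicit Types (f g u : R -> C) (t : R) (z w r : C).

Lemma partial_sum_tail (u : nat -> R) (s : R) (N j : nat) : 0 <= s < 1 ->
  (forall n, `|u n| <= s ^+ n) ->
  `|\sum_(n < N + j) u n - \sum_(n < N) u n| <= s ^+ N * (1 - s ^+ j) / (1 - s).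
Proof.
move=> /andP[s0 s1] hu; elim: j => [|j ih].
  by rewrite addn0 subrr normr0 expr0 subrr mulr0 mul0r.
rewrite addnS big_ord_recr /= addrAC.
apply: le_trans (ler_normD _ _) _.
apply: le_trans (lerD ih (hu _)) _.
rewrite exprD exprS le_eqVlt; apply/orP; left; apply/eqP; field.
by rewrite subr_eq0 eq_sym lt_eqF.
Qed.

(** [ext_fin] is built from [limn], which is meaningful only for convergent sequences; domination by
    a geometric series gives the convergence together with the tail bound. *)
Lemma limn_tail (u : nat -> R) (s : R) (N : nat) : 0 <= s < 1 ->
  (forall n, `|u n| <= s ^+ n) ->
  `|limn (fun M : nat => \sum_(n < M) u n) - \sum_(n < N) u n| <= s ^+ N / (1 - s).
Proof.
move=> s01 hu; have /andP[s0 s1] := s01.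
pose S := fun M : nat => \sum_(n < M) u n.
have cS : cvgn S.
  have -> : S = series u by rewrite seriesEord.
  apply: normed_cvg; apply: (@series_le_cvg _ _ (geometric 1 s)).
  - by move=> n /=; rewrite normr_ge0.
  - by move=> n; rewrite /geometric /= mul1r exprn_ge0.
  - by move=> n; rewrite /geometric /= ?mul1r.
  - by apply: is_cvg_geometric_series; rewrite ger0_norm.
have bnd M : (N <= M)%N -> `|S M - S N| <= s ^+ N / (1 - s).
  move=> NM; rewrite -(subnKC NM); apply: le_trans (partial_sum_tail N _ s01 hu) _.
  rewrite ler_pM2r ?invr_gt0 ?subr_gt0// ler_piMr ?exprn_ge0// gerBl exprn_ge0//.
rewrite ler_norml; apply/andP; split.
- rewrite lerBrDr; apply: limr_ge => //; near=> M.
  have := bnd M; rewrite ler_norml => /(_ _)/andP[]; last by rewrite /S; lra.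
  by near: M; exists N.
- rewrite lerBlDr; apply: limr_le => //; near=> M.
  have := bnd M; rewrite ler_norml => /(_ _)/andP[]; last by rewrite /S; lra.
  by near: M; exists N.
Unshelve. all: by end_near.
Qed.

Lemma geometric_small (s e : R) : 0 <= s < 1 -> 0 < e ->
  exists N0 : nat, forall N : nat, (N0 <= N)%N -> s ^+ N / (1 - s) <= e.
Proof.
move=> /andP[s0 s1] e0.
have h : (geometric 1 s : nat -> R) @ \oo --> (0 : R).
  by apply: cvg_geometric; rewrite ger0_norm.
have e1 : 0 < e * (1 - s) by rewrite mulr_gt0// subr_gt0.
have /cvgr0_norm_le /(_ _ e1) [N0 _ H] := h.
exists N0 => N N0N; have := H N N0N; rewrite /= mul1r ger0_norm ?exprn_ge0//.
by rewrite ler_pdivrMr// subr_gt0.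
Qed.

Lemma cabs_le_ReIm z (e : R) : `|complex.Re z| <= e -> `|complex.Im z| <= e ->
  cabs z <= 2 * e.
Proof.
case: z => x y /=; rewrite !ler_norml => /andP[x1 x2] /andP[y1 y2].
have e0 : 0 <= e by lra.
by rewrite cabs_le_sqn; [rewrite /sqn /=; nra | lra].
Qed.

Lemma abs_ReIm_le z (x : R) : 0 <= x -> sqn z <= x ^+ 2 ->
  `|complex.Re z| <= x /\ `|complex.Im z| <= x.
Proof.
move=> x0 zx; have h y : y ^+ 2 <= sqn z -> `|y| <= x.
  by move=> yz; rewrite -ler_sqr ?nnegrE// real_normK ?num_real//; exact: le_trans zx.
by split; apply: h; rewrite /sqn ?lerDl ?lerDr sqr_ge0.
Qed.

Lemma sqnX z n : sqn (z ^+ n) = sqn z ^+ n.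
Proof. by elim: n => [|n ih]; rewrite ?sqn1// !exprS sqnM ih. Qed.

Lemma toCX (s : R) n : toC (s ^+ n) = toC s ^+ n.
Proof.
elim: n => [|n ih]; first by rewrite !expr0.
by rewrite !exprS -ih /toC mulComplex; congr Complex; ring.
Qed.

(* Within the disc, the Abel polynomial at w is a partial sum of the expansion
   of the analytic extension at (s w)^-1. *)
Lemma abel_ext_fin (a : C -> C) (f := fun t => a (eT t)) (s e : R) :
  (forall n, sqn (fc f n) <= 1) -> 0 < s < 1 -> 0 < e ->
  exists N0 : nat, forall N : nat, (N0 <= N)%N -> forall w, w != 0 -> sqn w <= 1 ->
    cabs (ext_fin a (toC s * w)^-1 - (abel s N f).[w]) <= 2 * e.
Proof.
move=> f1 /andP[s0 s1] e0.
have s01 : 0 <= s < 1 by rewrite ltW.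
have [N0 HN] := geometric_small s01 e0; exists N0 => N N0N w w0 w1.
have term n : ext_term a (toC s * w)^-1 n = fc f (- n%:Z) * (toC s * w) ^+ n.
  rewrite /ext_term; congr (_ * _).
  by rewrite -exprnN exprVn invrK.
have tb n : sqn (ext_term a (toC s * w)^-1 n) <= (s ^+ n) ^+ 2.
  rewrite term sqnM sqnX sqnM sqn_toC exprMn exprAC.
  apply: le_trans (ler_piMl _ (f1 _)) _.
    by rewrite mulr_ge0// !exprn_ge0 ?sqn_ge0// ltW.
  by rewrite ler_piMr// ?exprn_ile1 ?sqn_ge0// !exprn_ge0// ltW.
have sX n : 0 <= s ^+ n by rewrite exprn_ge0// ltW.
have tbR n := (abs_ReIm_le (sX n) (tb n)).1.
have tbI n := (abs_ReIm_le (sX n) (tb n)).2.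
have -> : (abel s N f).[w] = \sum_(n < N) ext_term a (toC s * w)^-1 n.
  rewrite /abel horner_poly; apply: eq_bigr => n _.
  by rewrite term toCX exprMn; ring.
have ReS (F : nat -> C) : complex.Re (\sum_(n < N) F n) = \sum_(n < N) complex.Re (F n).
  by apply: (big_morph (@complex.Re R)) => // -[? ?] [].
have ImS (F : nat -> C) : complex.Im (\sum_(n < N) F n) = \sum_(n < N) complex.Im (F n).
  by apply: (big_morph (@complex.Im R)) => // -[? ?] [].
have ReB (x y : C) : complex.Re (x - y) = complex.Re x - complex.Re y.
  by case: x y => ? ? [].
have ImB (x y : C) : complex.Im (x - y) = complex.Im x - complex.Im y.
  by case: x y => ? ? [].
apply: cabs_le_ReIm.
- rewrite ReB ReS /ext_fin; apply: le_trans (HN _ N0N).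
  exact: limn_tail s01 tbR.
- rewrite ImB ImS /ext_fin; apply: le_trans (HN _ N0N).
  exact: limn_tail s01 tbI.
Qed.

Definition rhalf : R := Num.sqrt 2^-1.

Lemma rhalf_ge0 : 0 <= rhalf. Proof. exact: sqrtr_ge0. Qed.

Lemma rhalf_sqr : rhalf ^+ 2 = 2^-1.
Proof. by rewrite sqr_sqrtr// invr_ge0 ler0n. Qed.

Lemma cLinf_horner_eT (P : {poly C}) : cLinf (fun t => P.[(eT t)^-1]).
Proof.
rewrite -[P]polyseqK; apply: cLinf_ext (fun t => esym (horner_Poly _ _)) _.
have cE : cLinf (fun t : R => (eT t)^-1).
  by apply: cLinf_ext (@cLinf_eT_exp R (-1)) => t; rewrite eT_inv.
elim: (polyseq P) => [|c p ih] //=.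
by apply: cLinfD => //; exact: cLinfM.
Qed.

(** A working form of being an outer function, stated in w = 1/z. The common lower bound lets
    quotients converge, and exact agreement at w = 0 preserves the value at infinity. *)
Definition outer_approximable f : Prop :=
  forall d : R, 0 < d -> exists P : {poly C},
    [/\ forall w, sqn w <= 1 -> 2^-1 <= sqn P.[w],
        P.[0] = fc f 0 & n2 (fun t => f t - P.[(eT t)^-1]) <= d].

Lemma outer_approx (a : C -> C) (f := fun t => a (eT t)) (eps : R) :
  cLinf f -> (forall n, sqn (fc f n) <= 1) -> tpoly_closure (fun n => n <= 0) f ->
  0 < eps ->
  (forall z, 1 < cabs z -> rhalf + eps <= cabs (ext_fin a z)) ->
  rhalf + eps <= cabs (fc f 0) -> outer_approximable f.
Proof.
move=> hf f1 clf eps0 hext hinf d d0.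
have [h h0 H] := abelT_cl hf clf d0.
(* Halving makes s = 1 - k strictly positive even when [h] is large. *)
pose k := Num.min h 1 / 2.
have [k0 kh k1] : [/\ 0 < k, k <= h & k < 1].
  have m0 : 0 < Num.min h 1 by rewrite lt_min h0 ltr01.
  have : Num.min h 1 <= h by rewrite ge_min lexx.
  have : Num.min h 1 <= 1 by rewrite ge_min lexx orbT.
  by rewrite /k; move: (Num.min h 1) m0 => m; split; lra.
pose s := 1 - k.
have s0 : 0 < s by rewrite subr_gt0.
have s1 : s < 1 by rewrite gtrBl.
have [||N1 HN1] := H s; [by apply/andP; split; rewrite /s; lra | exact: ltW |].
have s01 : 0 < s < 1 by rewrite s0.
(* The truncation estimate doubles its parameter, so eps / 2 uses up exactly the margin eps. *)
have eps2 : 0 < eps / 2 by rewrite divr_gt0.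
have [N2 HN2] := abel_ext_fin f1 s01 eps2.
pose N := (maxn N1 N2).+1.
have N1N : (N1 <= N)%N by rewrite /N leqW// leq_maxl.
have N2N : (N2 <= N)%N by rewrite /N leqW// leq_maxr.
have P0 : (abel s N f).[0] = fc f 0.
  rewrite horner_coef0 coef_poly /= expr0.
  by rewrite -[RHS]mul1r.
exists (abel s N f); split => //; last exact: HN1.
move=> w w1; rewrite -rhalf_sqr -le_cabs_sqn ?rhalf_ge0//.
(* The point w = 0 stands for infinity, where the bound on [ext_inf] applies instead of that on
   [ext_fin]. *)
have [->|w0] := eqVneq w 0; first by rewrite P0; apply: le_trans hinf; rewrite lerDl ltW.
have z1 : 1 < cabs (toC s * w)^-1.
  have q0 : 0 < sqn w by rewrite lt_def sqn_ge0 sqn_eq0 w0.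
  have s20 : 0 < s ^+ 2 by rewrite exprn_gt0.
  have sq0 : 0 < s ^+ 2 * sqn w by rewrite mulr_gt0.
  rewrite cabsE -[ltLHS]sqrtr1 sqnV sqnM sqn_toC ltr_sqrt ?invr_gt0// invf_gt1//.
  apply: (@le_lt_trans _ _ (s ^+ 2)); first by rewrite ler_piMr// ltW.
  by rewrite expr_lt1// ltW.
have := hext _ z1; have := HN2 N N2N w w0 w1.
have := cabsB_ge (ext_fin a (toC s * w)^-1) (abel s N f).[w].
move: (cabs _) (cabs _) (cabs _) => x y z; lra.
Qed.

(** No radial limits are taken: the amount [phi] by which |f| falls below 2^(-1/2) is at most |f -
    P| for every admissible polynomial P, hence has norm zero. *)
Lemma outer_lower_bound (a : C -> C) (f := fun t => a (eT t)) : cLinf f ->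
  outer_approximable f ->
  ae01 (fun t => 2^-1 <= sqn (f t)).
Proof.
move=> hf H.
pose phi t := Num.max 0 (rhalf - cabs (f t)).
have cphi : Linf phi.
  by apply: Linf_max; apply: LinfB => //; apply/Linf_sqrt/Linf_sqn.
have phi0 t : 0 <= phi t by rewrite le_max lexx.
have cphi2 := LinfM cphi cphi.
have int0 : int01 (fun t => phi t * phi t) = 0.
  apply/eqP; rewrite eq_le int01_ge0 ?andbT; last by move=> t; exact: mulr_ge0.
  apply: (@le_eps _ _ 1) => // d d0; have [P [P1 _ fP]] := H d d0.
  rewrite mul1r; apply: le_trans fP.
  have cP := cLinf_horner_eT P.
  apply: int01_le => //; first exact/Linf_sqn/cLinfB.
  apply: ae01W => t.
  have p1 : sqn (eT t)^-1 <= 1 by rewrite sqnV sqn_eT invr1.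
  have := P1 _ p1; rewrite -rhalf_sqr -le_cabs_sqn ?rhalf_ge0// => Pt.
  have := cabsB_ge P.[(eT t)^-1] (f t); rewrite -(cabsN (P.[_] - _)) opprB => fP.
  have c0 := cabs_ge0 (f t - P.[(eT t)^-1]).
  rewrite -sqr_cabs -expr2 ler_sqr ?nnegrE// /phi ge_max c0 /=.
  by apply: le_trans fP; rewrite lerB.
have := int01_eq0 cphi2 (fun t => mulr_ge0 (phi0 t) (phi0 t)) int0.
apply: ae01_imp => t /eqP; rewrite mulf_eq0 orbb => /eqP p0.
rewrite -rhalf_sqr -le_cabs_sqn ?rhalf_ge0// -subr_le0 -p0.
by rewrite /phi le_max lexx orbT.
Qed.

(** For u / P the claims hold by [fc_div_poly]. The lower bounds on |f| and |P| give |u / f - u / P|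
    <= 2 |f - P|, so the coefficients of u / P converge to those of u / f. *)
Lemma fc_div_outer (a : C -> C) (f := fun t => a (eT t)) u (v := fun t => u t / f t) :
  cLinf f ->
  outer_approximable f ->
  cLinf u -> ae01 (fun t => sqn (u t) <= 1) ->
  (forall n : int, 0 < n -> fc u n = 0) ->
  [/\ cLinf v, forall n : int, 0 < n -> fc v n = 0 & fc v 0 * fc f 0 = fc u 0].
Proof.
move=> hf H hu u1 u0; have low := outer_lower_bound hf H.
have half0 : 0 < 2^-1 :> R by rewrite invr_gt0 ltr0n.
have cv : cLinf v by apply: cLinfM => //; exact: cLinf_inv half0 low hf.
have key (d : R) : 0 < d -> exists y : int -> C,
    [/\ forall n, sqn (fc v n - y n) <= 4 * d, forall n : int, 0 < n -> y n = 0
      & y 0 * fc f 0 = fc u 0].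
  move=> d0; have [P [P1 P0 fP]] := H d d0.
  have Pn0 w : sqn w <= 1 -> P.[w] != 0.
    by move=> /P1; rewrite -sqn_eq0 => /(lt_le_trans half0) /gt_eqF ->.
  have [cw w0 we] := fc_div_poly hu u0 Pn0.
  exists (fc (fun t => u t / P.[(eT t)^-1])); split => //; last by rewrite -P0.
  move=> n; rewrite -fcB//; apply: le_trans (sqn_fc_le n (cLinfB cv cw)) _.
  have cP := cLinf_horner_eT P.
  have cfP := cLinfB hf cP.
  apply: (@le_trans _ _ (n2 (fun t => 2 * (f t - P.[(eT t)^-1])))).
    apply: n2_le; [exact: cLinfB | exact: cLinfM |].
    apply: ae01_imp2 u1 low => t ut ft.
    have p1 : sqn (eT t)^-1 <= 1 by rewrite sqnV sqn_eT invr1.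
    have Pt := P1 _ p1; have Pt0 := Pn0 _ p1.
    have ft0 : f t != 0 by rewrite -sqn_eq0 gt_eqF// (lt_le_trans half0).
    have -> : v t - u t / P.[(eT t)^-1] =
        - (u t * (f t - P.[(eT t)^-1]) * (f t * P.[(eT t)^-1])^-1).
      by rewrite /v; field; rewrite Pt0.
    rewrite sqnN !sqnM sqnV sqnM.
    have -> : sqn (2 : C) = 4 by rewrite /sqn /=; ring.
    have D0 := sqn_ge0 (f t - P.[(eT t)^-1]); have U0 := sqn_ge0 (u t).
    have inv4 : (sqn (f t) * sqn P.[(eT t)^-1])^-1 <= 4.
      rewrite -[4]invrK lef_pV2 ?posrE ?invr_gt0 ?ltr0n//; last first.
        by rewrite mulr_gt0// (lt_le_trans half0).
      have -> : 4^-1 = 2^-1 * 2^-1 :> R by field.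
      by apply: ler_pM => //; exact: ltW.
    rewrite mulrC; apply: ler_pM => //.
    - by rewrite invr_ge0 mulr_ge0// sqn_ge0.
    - exact: mulr_ge0.
    - exact: ler_piMl.
  rewrite n2Z//.
  have -> : sqn (2 : C) = 4 by rewrite /sqn /=; ring.
  by rewrite ler_wpM2l.
split => // [n n0|].
- apply/eqP; rewrite -sqn_eq0 eq_le sqn_ge0 andbT.
  apply: (@le_eps _ _ 4) => // d d0; have [y [yn y0 _]] := key d d0.
  by have := yn n; rewrite y0// subr0.
- apply/eqP; rewrite -subr_eq0 -sqn_eq0 eq_le sqn_ge0 andbT.
  have F0 := sqn_ge0 (fc f 0).
  apply: (@le_eps _ _ (4 * sqn (fc f 0))); first by rewrite mulr_ge0.
  move=> d d0; have [y [yn _ <-]] := key d d0.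
  by rewrite -mulrBl sqnM mulrAC ler_wpM2r.
Qed.

End Outer.

(** * The factorisation of (a, b), the real-linear system and the energy estimate *)

Section Factorization.
Variable R : realType.
Local Notation C := R[i].
Implicit Types (a b c d : C -> C) (F : int -> C) (t : R) (z w : C).

Lemma star_eT a t : star a (eT t) = conjc (a (eT t)).
Proof. by rewrite /star !cconjE conj_eT invrK. Qed.

Lemma inL_sqn a b : inL a b -> ae01 (fun t => sqn (a (eT t)) + sqn (b (eT t)) = 1).
Proof.
move=> [_ [_ [h _]]]; apply: ae01_imp h => t; rewrite !star_eT -!sqnE.
by move=> /(congr1 (@complex.Re R)).
Qed.

Lemma sum1_le1 (x y : R) : 0 <= x -> 0 <= y -> x + y = 1 -> x <= 1 /\ y <= 1.
Proof. by move=> x0 y0 h; split; lra. Qed.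

Lemma inL_sqn_le1 a b : inL a b ->
  ae01 (fun t => sqn (a (eT t)) <= 1) /\ ae01 (fun t => sqn (b (eT t)) <= 1).
Proof.
move=> /inL_sqn h; split; apply: ae01_imp h => t h;
  by have [] := sum1_le1 (sqn_ge0 _) (sqn_ge0 _) h.
Qed.

Lemma inL_cLinf a b : inL a b -> cLinf (fun t => a (eT t)) /\ cLinf (fun t => b (eT t)).
Proof.
move=> hL; have [a1 b1] := inL_sqn_le1 hL.
have [[ma1 [ma2 _]] [[mb1 [mb2 _]] _]] := hL.
by split; [exact: cLinf_bounded a1 | exact: cLinf_bounded b1].
Qed.

Lemma inL_fc a b : inL a b -> forall n : int, 0 < n -> fc (fun t => a (eT t)) n = 0.
Proof. by move=> [_ [_ [_ [[_ h] _]]]] n /h. Qed.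

Lemma inL_fc0 a b : inL a b ->
  exists2 A : R, 0 < A & fc (fun t => a (eT t)) 0 = toC A.
Proof.
move=> [_ [_ [_ [_ h]]]]; exists (complex.Re (ext_inf a)).
  by move: h; rewrite ltcE /= => /andP[].
move: h; rewrite ltcE /= => /andP[/eqP h _].
by apply/eqP; rewrite eq_complex eqxx /=; apply/eqP.
Qed.

Lemma L2norm_sqr (f : C -> C) : L2norm f ^+ 2 = n2 (fun t => f (eT t)).
Proof.
have e : L2norm f = Num.sqrt (n2 (fun t => f (eT t))).
  by congr Num.sqrt; apply: int01_ext => t; exact: sqr_cabs.
by rewrite e sqr_sqrtr// n2_ge0.
Qed.

Lemma L2norm_ge0 (f : C -> C) : 0 <= L2norm f. Proof. exact: sqrtr_ge0. Qed.

Lemma rho_small (u : nat -> (C -> C) * (C -> C)) (p : (C -> C) * (C -> C)) :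
  (fun k => rho (u k) p) @ \oo --> (0 : R) -> forall e : R, 0 < e ->
  exists k, n2 (fun t => p.1 (eT t) - (u k).1 (eT t)) <= e /\
            n2 (fun t => p.2 (eT t) - (u k).2 (eT t)) <= e.
Proof.
move=> h e e0; have se0 : 0 < Num.sqrt e by rewrite sqrtr_gt0.
have /cvgr0_norm_le /(_ _ se0) [N0 _ H] := h.
exists N0; have /= := H N0 (leqnn _); rewrite /rho.
set x := L2norm _; set y := L2norm _; set z := `| _ - _ |.
have [x0 y0 z0] : [/\ 0 <= x, 0 <= y & 0 <= z].
  by split; [exact: L2norm_ge0 | exact: L2norm_ge0 | exact: normr_ge0].
move=> hN; have {hN} : x + y + z <= Num.sqrt e by apply: le_trans hN; exact: ler_norm.
move=> hN; have [xe ye] : x <= Num.sqrt e /\ y <= Num.sqrt e.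
  by move: hN; move: (Num.sqrt e) => s; split; lra.
have sq v : 0 <= v -> v <= Num.sqrt e -> v ^+ 2 <= e.
  by move=> v0 ve; rewrite -[leRHS](sqr_sqrtr (ltW e0)) ler_sqr ?nnegrE// sqrtr_ge0.
have sym (g h' : R -> C) : n2 (fun t => g t - h' t) = n2 (fun t => h' t - g t).
  by apply: int01_ext => t; rewrite -sqnN opprB.
rewrite sym -(L2norm_sqr (fun z => (u N0).1 z - p.1 z)).
rewrite [n2 (fun t => p.2 _ - _)]sym -(L2norm_sqr (fun z => (u N0).2 z - p.2 z)).
by split; apply: sq.
Qed.

(** Here p = a_+, q = b_+, u = a_-, v = b_- on the circle and A = a_+(oo). [fact_q0] with [fact_p0]
    is the limit of [win_fc0]; [fact_a0] is multiplicativity at infinity. *)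
Record factors a b F (p q u v : R -> C) (A : R) : Prop := Factors {
  fact_cp : cLinf p; fact_cq : cLinf q; fact_cu : cLinf u; fact_cv : cLinf v;
  fact_pq : ae01 (fun t => sqn (p t) + sqn (q t) = 1);
  fact_u1 : ae01 (fun t => sqn (u t) <= 1);
  fact_v1 : ae01 (fun t => sqn (v t) <= 1);
  fact_a : ae01 (fun t => a (eT t) = u t * p t - v t * conjc (q t));
  fact_b : ae01 (fun t => b (eT t) = u t * q t + v t * conjc (p t));
  fact_u : forall n : int, 0 < n -> fc u n = 0;
  fact_v : forall n : int, 0 <= n -> fc v n = 0;
  fact_clp : tpoly_closure (fun n => 0 <= n) (fun t => conjc (p t));
  fact_clq : tpoly_closure (fun n => 0 <= n) q;
  fact_cla : tpoly_closure (fun n => n <= 0) (fun t => a (eT t));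
  fact_A : 0 < A;
  fact_p0 : fc p 0 = toC A;
  fact_q0 : fc q 0 = F 0 * toC A;
  fact_a0 : fc (fun t => a (eT t)) 0 = fc u 0 * toC A }.

Lemma nlft_factors a b F : inL a b -> is_nlft F a b ->
  exists p q u v A, factors a b F p q u v A.
Proof.
move=> hab [ap [bp [am [bm [hp [hm [rp [rm [ea eb]]]]]]]]].
pose p t := ap (eT t); pose q t := bp (eT t).
pose u t := am (eT t); pose v t := bm (eT t).
pose f t := a (eT t).
have [cf _] := inL_cLinf hab.
have [cp cq] := inL_cLinf hp; have [cu cv] := inL_cLinf hm.
have [p1 q1] := inL_sqn_le1 hp; have [u1 v1] := inL_sqn_le1 hm.
have pq := inL_sqn hp.
have [A A0 pA] := inL_fc0 hp.
have win0 e : 0 < e -> exists N,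
    [/\ n2 (fun t => p t - win_a F 0 N.+1 t) <= e
      & n2 (fun t => q t - win_b F 0 N.+1 t) <= e].
  by move=> e0; have [k [h1 h2]] := rho_small rp e0; exists k.
have winm e : 0 < e -> exists k : nat,
    [/\ n2 (fun t => u t - win_a F (- k%:Z) k t) <= e
      & n2 (fun t => v t - win_b F (- k%:Z) k t) <= e].
  by move=> e0; have [k [h1 h2]] := rho_small rm e0; exists k.
have wa m N : tpoly (fun n => n <= 0) (win_a F m N).
  by apply: tpoly_sub (win_tpoly F m N).1 => n [].
have wbp N : tpoly (fun n => 0 <= n) (win_b F 0 N).
  by apply: tpoly_sub (win_tpoly F 0 N).2 => n /andP[].
have wbm k : tpoly (fun n => n < 0) (win_b F (- k%:Z) k).
  by apply: tpoly_sub (win_tpoly F (- k%:Z) k).2 => n; lia.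
have clp : tpoly_closure (fun n => n <= 0) p.
  by move=> e /win0[N [h _]]; exists (win_a F 0 N.+1).
have clq : tpoly_closure (fun n => 0 <= n) q.
  by move=> e /win0[N [_ h]]; exists (win_b F 0 N.+1).
have clcp : tpoly_closure (fun n => 0 <= n) (fun t => conjc (p t)).
  by apply: cl_conj clp => n; lia.
have clv : tpoly_closure (fun n => n < 0) v.
  by move=> e /winm[k [_ h]]; exists (win_b F (- k%:Z) k).
have v0 (n : int) : 0 <= n -> fc v n = 0.
  by move=> n0; apply: (cl_fc cv clv); lia.
have fa : ae01 (fun t => f t = u t * p t - v t * conjc (q t)).
  by apply: ae01_imp ea => t; rewrite star_eT.
have ccq := cLinf_conj cq; have ccp := cLinf_conj cp.
have cup := cLinfM cu cp; have cvq := cLinfM cv ccq.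
exists p, q, u, v, A; split => //.
- by apply: ae01_imp eb => t; rewrite star_eT.
- exact: inL_fc hm.
(* Products of windows approximate a. The loss is a factor 4 in [cl_mul] and a factor 4 in splitting
   the two products. *)
- move=> e e0; have e16 : 0 < e / 16 by rewrite divr_gt0.
  have [N [hp1 hq1]] := win0 _ e16; have [k [hu1 hv1]] := winm _ e16.
  have lesum (n m : int) : n <= 0 -> m <= 0 -> n + m <= 0 by lia.
  have ltsum (n m : int) : n < 0 -> m <= 0 -> n + m <= 0 by lia.
  have win1 m M t := (win_sqn_le1 F m M t).1.
  have win2 t : sqn (conjc (win_b F 0 N.+1 t)) <= 1.
    by rewrite sqn_conj; exact: (win_sqn_le1 F 0 N.+1 t).2.
  have wcb : tpoly (fun n => n <= 0) (fun t => conjc (win_b F 0 N.+1 t)).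
    by apply: tpoly_conj (wbp N.+1) => n; lia.
  have hcq1 : n2 (fun t => conjc (q t) - conjc (win_b F 0 N.+1 t)) <= e / 16.
    rewrite (_ : (fun t => _) = (fun t => conjc (q t - win_b F 0 N.+1 t))) ?n2_conj//.
    by apply/funext => t; rewrite conjcB.
  have [t1 b1] := cl_mul (S'' := fun n => n <= 0) lesum cu cp
    (wa _ k) (wa 0 N.+1) u1 (win1 _ _) hu1 hp1.
  have [t2 b2] := cl_mul (S'' := fun n => n <= 0) ltsum cv ccq (wbm k) wcb v1 win2 hv1 hcq1.
  pose P1 t := win_a F (- k%:Z) k t * win_a F 0 N.+1 t.
  pose P2 t := win_b F (- k%:Z) k t * conjc (win_b F 0 N.+1 t).
  have [c1 c2] : cLinf P1 /\ cLinf P2 by split; [exact: tpoly_cLinf t1 | exact: tpoly_cLinf t2].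
  exists (fun t => P1 t - P2 t); first exact: tpolyB.
  have d1 := cLinfB cup c1; have d2 := cLinfB cvq c2.
  apply: (@le_trans _ _ (n2 (fun t => (u t * p t - P1 t) + - (v t * conjc (q t) - P2 t)))).
    apply: n2_le; [by apply: cLinfB => //; exact: cLinfB | by apply: cLinfD => //; exact: cLinfN |].
    apply: ae01_imp fa => t; rewrite /f => ->.
    by rewrite le_eqVlt; apply/orP; left; apply/eqP; congr sqn; ring.
  apply: le_trans (n2D_le d1 (cLinfN d2)) _; rewrite n2N.
  have e4 : 4 * (e / 16) = e / 4 by field.
  by apply: quarter_bound; rewrite -e4.
(* [win_fc0] is exact for every window, so only the two approximation errors remain, the second
   weighted by |F_0|. *)
- have cA := cLinf_conj cp.
  apply/eqP; rewrite -subr_eq0 -sqn_eq0 eq_le sqn_ge0 andbT.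
  apply: (@le_eps _ _ (2 * (1 + sqn (F 0)))).
    by rewrite mulr_ge0// addr_ge0// sqn_ge0.
  move=> e e0; have [N [h1 h2]] := win0 _ e0.
  have [ca cb] := (tpoly_cLinf (wa 0 N.+1), tpoly_cLinf (wbp N.+1)).
  have w0 := win_fc0 F N.
  have -> : fc q 0 - F 0 * toC A = (fc q 0 - fc (win_b F 0 N.+1) 0)
      + - (F 0 * conjc (fc p 0 - fc (win_a F 0 N.+1) 0)).
    rewrite w0 conjcB pA (_ : conjc (toC A) = toC A); last by rewrite /toC /= oppr0.
    by ring.
  apply: le_trans (sqnD_le _ _) _; rewrite sqnN sqnM sqn_conj -!fcB//.
  have g1 := le_trans (sqn_fc_le 0 (cLinfB cp ca)) h1.
  have g2 := le_trans (sqn_fc_le 0 (cLinfB cq cb)) h2.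
  rewrite -mulrA; apply: ler_wpM2l => //; rewrite [leRHS]mulrDl [in leRHS]mul1r; apply: lerD => //.
  by apply: ler_wpM2l => //; exact: sqn_ge0.
(* The product of b_- with the conjugate of b_+ has mean zero, because b_- has only negative and b_+
   only nonnegative frequencies. *)
- rewrite (fc_ae_eq 0 cf (cLinfB cup cvq) fa) fcB//.
  have -> : fc (fun t => v t * conjc (q t)) 0 = 0.
    rewrite -(cl_ip cv cq v0 clq); apply: cint_ext => t.
    by rewrite oppr0 expr0z mulr1.
  have -> : fc (fun t => u t * p t) 0 = ip u (fun t => conjc (p t)).
    by apply: cint_ext => t; rewrite oppr0 expr0z mulr1 conjcK.
  rewrite (ip_analytic cu ccp (inL_fc hm) clcp) subr0.
  by rewrite fc_conj// conjcK oppr0 pA.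
Qed.

(* The normalised right factor (alpha, beta) = (A a_+^*, A b_+) solves the
   real-linear system alpha + r beta^* = U, beta - r alpha^* = V with r = b / a. *)
Record solution a b F (al be U V : R -> C) (A : R) : Prop := Solution {
  sol_cal : cLinf al; sol_cbe : cLinf be; sol_cU : cLinf U; sol_cV : cLinf V;
  sol_clal : tpoly_closure (fun n => 0 <= n) al; sol_clbe : tpoly_closure (fun n => 0 <= n) be;
  sol_U : forall n : int, 0 <= n -> fc U n = (n == 0)%:R;
  sol_V : forall n : int, 0 <= n -> fc V n = 0;
  sol_norm : ae01 (fun t => sqn (al t) + sqn (be t) = A ^+ 2);
  sol_a : ae01 (fun t => 2^-1 <= sqn (a (eT t)));
  sol_eqU : ae01 (fun t => al t + b (eT t) / a (eT t) * conjc (be t) = U t);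
  sol_eqV : ae01 (fun t => be t - b (eT t) / a (eT t) * conjc (al t) = V t);
  sol_A : 2^-1 <= A ^+ 2 <= 1;
  sol_al0 : fc al 0 = toC (A ^+ 2);
  sol_be0 : fc be 0 = F 0 * toC (A ^+ 2) }.

Lemma n2_le1 (f : R -> C) : cLinf f -> ae01 (fun t => sqn (f t) <= 1) -> n2 f <= 1.
Proof.
move=> hf f1; rewrite -[leRHS](@int01_cst R).
by apply: int01_le => //; exact: Linf_sqn.
Qed.

Lemma inBeps_inL (eps : R) a b : inBeps eps a b -> inL a b.
Proof. by case=> [[]]. Qed.

(** Multiplying the product relation by the inverse of the unitary right factor gives a a_+^* + b
    b_+^* = a_-, to be divided by a. Conjugates are separate variables, so the identity is purely
    algebraic. *)
Lemma factor_relU (k p q pc qc u v x y : C) : x != 0 ->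
  x = u * p - v * qc -> y = u * q + v * pc -> p * pc + q * qc = 1 ->
  k * pc + y / x * (k * qc) = k * (u / x).
Proof.
move=> x0 ex ey h; have -> : k * pc + y / x * (k * qc) = k * ((x * pc + y * qc) / x) by field.
have -> : x * pc + y * qc = u * (p * pc + q * qc) by rewrite ex ey; ring.
by rewrite h mulr1.
Qed.

(** The other entry of the same inversion: b a_+ - a b_+ = b_-. *)
Lemma factor_relV (k p q pc qc u v x y : C) : x != 0 ->
  x = u * p - v * qc -> y = u * q + v * pc -> p * pc + q * qc = 1 ->
  k * q - y / x * (k * p) = - k * (v / x).
Proof.
move=> x0 ex ey h; have -> : k * q - y / x * (k * p) = - k * ((y * p - x * q) / x) by field.
have -> : y * p - x * q = v * (p * pc + q * qc) by rewrite ex ey; ring.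
by rewrite h mulr1.
Qed.

Lemma nlft_solution (eps : R) a b F : 0 < eps -> inBeps eps a b -> is_nlft F a b ->
  exists al be U V A, solution a b F al be U V A.
Proof.
move=> eps0 hB hF; have hL := inBeps_inL hB.
have [p [q [u [v [A []]]]]] := nlft_factors hL hF.
move=> cp cq cu cv pq u1 v1 ea eb u0 v0 clp clq cla A0 p0 q0 a0.
have [ca _] := inL_cLinf hL; have [a1 _] := inL_sqn_le1 hL.
pose f t := a (eT t).
have f1 n : sqn (fc f n) <= 1.
  exact: le_trans (sqn_fc_le n ca) (n2_le1 ca a1).
have [_ [hext hinf]] := hB.
have H := outer_approx ca f1 cla eps0 hext hinf.
have low := outer_lower_bound ca H.
have [cU U0 UE] := fc_div_outer ca H cu u1 u0.
have v0' (n : int) : 0 < n -> fc v n = 0 by move=> /ltW /v0.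
have [cV V0 VE] := fc_div_outer ca H cv v1 v0'.
have f0low : 2^-1 <= sqn (fc f 0).
  rewrite -rhalf_sqr -le_cabs_sqn ?rhalf_ge0//; apply: le_trans hinf.
  by rewrite lerDl ltW.
have f0n0 : fc f 0 != 0.
  by rewrite -sqn_eq0 gt_eqF// (lt_le_trans _ f0low)// invr_gt0 ltr0n.
have un0 : fc u 0 != 0.
  by move: f0n0; rewrite a0 mulf_eq0 negb_or => /andP[].
have p1 : ae01 (fun t => sqn (p t) <= 1).
  by apply: ae01_imp pq => t h; have [] := sum1_le1 (sqn_ge0 _) (sqn_ge0 _) h.
have AA : toC (A ^+ 2) = toC A * toC A by rewrite toCX expr2.
have cjA : conjc (toC A) = toC A by rewrite /toC /= oppr0.
pose al t := toC A * conjc (p t); pose be t := toC A * q t.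
pose U t := toC A * (u t / f t); pose V t := - toC A * (v t / f t).
have ccp := cLinf_conj cp.
have half0 : 0 < 2^-1 :> R by rewrite invr_gt0 ltr0n.
have fn0 t : 2^-1 <= sqn (f t) -> f t != 0.
  by move=> h; rewrite -sqn_eq0 gt_eqF// (lt_le_trans half0).
have pqC t : sqn (p t) + sqn (q t) = 1 -> p t * conjc (p t) + q t * conjc (q t) = 1.
  by move=> h; rewrite -!sqnE /toC addComplex h addr0.
exists al, be, U, V, A; split => //.
- exact: cLinfM.
- exact: cLinfM.
- exact: cLinfM.
- exact: cLinfM.
- exact: clZ.
- exact: clZ.
- move=> n; rewrite le_eqVlt => /predU1P[<-|n0]; rewrite fcZ//; last first.
    by rewrite U0// mulr0 gt_eqF.
  (* The values at infinity satisfy (u/a) a = u and a = u A; cancelling that of u leaves A (u/a) =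
     1. *)
  by rewrite eqxx; apply: (mulfI un0); rewrite mulr1 -[RHS]UE a0; ring.
- move=> n; rewrite le_eqVlt => /predU1P[<-|n0]; rewrite fcZ//; last first.
    by rewrite V0// mulr0.
  move: VE; rewrite v0// => /eqP; rewrite mulf_eq0 (negbTE f0n0) orbF => /eqP ->.
  by rewrite mulr0.
- apply: ae01_imp pq => t h; rewrite /al /be !sqnM sqn_conj sqn_toC.
  by rewrite -mulrDr h mulr1.
- apply: ae01_imp2 (ae01_and ea eb) (ae01_and pq low) => t [eat ebt] [/pqC h /fn0 ft].
  by rewrite /be conjcM cjA; exact: factor_relU ft eat ebt h.
- apply: ae01_imp2 (ae01_and ea eb) (ae01_and pq low) => t [eat ebt] [/pqC h /fn0 ft].
  by rewrite /al conjcM cjA conjcK; exact: factor_relV ft eat ebt h.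
(* Since a(oo) = a_-(oo) A with |a_-(oo)| <= 1, the lower bound on a(oo) passes to A. *)
- apply/andP; split.
    apply: le_trans f0low _; rewrite a0 sqnM sqn_toC.
    rewrite ler_piMl ?sqr_ge0//.
    exact: le_trans (sqn_fc_le 0 cu) (n2_le1 cu u1).
  rewrite -sqn_toC -p0.
  exact: le_trans (sqn_fc_le 0 cp) (n2_le1 cp p1).
- by rewrite fcZ// fc_conj// oppr0 p0 cjA AA.
- by rewrite fcZ// q0 AA; ring.
Qed.

Lemma lagrange_le (x y z w : C) :
  sqn (x * y + z * w) <= (sqn x + sqn z) * (sqn y + sqn w).
Proof.
have -> : (sqn x + sqn z) * (sqn y + sqn w) =
    sqn (x * y + z * w) + sqn (x * conjc w - z * conjc y).
  by case: x y z w => [? ?] [? ?] [? ?] [? ?]; rewrite /sqn /=; ring.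
by rewrite lerDl sqn_ge0.
Qed.

(** Over the denominator ac, the numerator pairs the unit vector (b, a) with (-(a - c), b - d). The
    denominator contributes |ac|^(-2) <= 4. *)
Lemma quotient_diff_le (a b c d : C) : 2^-1 <= sqn a -> 2^-1 <= sqn c ->
  sqn a + sqn b = 1 -> sqn (b / a - d / c) <= 4 * (sqn (a - c) + sqn (b - d)).
Proof.
move=> ha hc ab; have h0 : 0 < 2^-1 :> R by rewrite invr_gt0 ltr0n.
have a0 : a != 0 by rewrite -sqn_eq0 gt_eqF// (lt_le_trans h0).
have c0 : c != 0 by rewrite -sqn_eq0 gt_eqF// (lt_le_trans h0).
have -> : b / a - d / c = (b * (- (a - c)) + a * (b - d)) * (a * c)^-1.
  by field; rewrite ?a0 ?c0.
rewrite sqnM sqnV sqnM mulrC.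
apply: ler_pM; rewrite ?sqn_ge0 ?invr_ge0 ?mulr_ge0 ?sqn_ge0//.
  rewrite -[4]invrK lef_pV2 ?posrE ?invr_gt0 ?ltr0n//; last first.
    by rewrite mulr_gt0// (lt_le_trans h0).
  have -> : 4^-1 = 2^-1 * 2^-1 :> R by field.
  by apply: ler_pM => //; exact: ltW.
by apply: le_trans (lagrange_le _ _ _ _) _; rewrite addrC ab mul1r sqnN.
Qed.

(* Pairing the difference of two solutions with itself: the terms in [r]
   cancel, only the perturbation [r - r'] survives. *)
Lemma energy_pointwise (r r' al be al' be' U V U' V' : C) (X : R) :
  al + r * conjc be = U -> be - r * conjc al = V ->
  al' + r' * conjc be' = U' -> be' - r' * conjc al' = V' ->
  sqn al' + sqn be' <= 1 -> sqn (r - r') <= 4 * X ->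
  sqn (al - al') + sqn (be - be') <=
  2 * complex.Re ((U - U') * conjc (al - al') + (V - V') * conjc (be - be')) + 4 * X.
Proof.
move=> <- <- <- <- h1 hX; apply: le_trans (lerD (lexx _) hX).
pose x := al - al'; pose y := be - be'.
pose h := conjc be' * conjc x + - conjc al' * conjc y.
have -> : (al + r * conjc be - (al' + r' * conjc be')) * conjc (al - al') +
   (be - r * conjc al - (be' - r' * conjc al')) * conjc (be - be') =
   toC (sqn x + sqn y) + (r - r') * h.
  have -> : toC (sqn x + sqn y) = x * conjc x + y * conjc y.
    by rewrite -!sqnE /toC addComplex addr0.
  by rewrite /h /x /y !conjcB; ring.
have hh : sqn h <= sqn x + sqn y.
  apply: le_trans (lagrange_le _ _ _ _) _.
  rewrite !sqn_conj sqnN sqn_conj; apply: ler_piMl; first by rewrite addr_ge0// sqn_ge0.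
  by rewrite addrC.
(* Doubling the real part yields twice the energy, of which one copy absorbs [sqn h]. *)
have amgm (z w : C) : - (sqn z + sqn w) <= 2 * complex.Re (z * w).
  case: z w => z1 z2 [w1 w2]; rewrite /sqn /=.
  have := sqr_ge0 (z1 + w1); have := sqr_ge0 (z2 - w2); nra.
have ReD (E : R) z : complex.Re (toC E + z) = E + complex.Re z by case: z.
rewrite ReD; have := amgm (r - r') h.
rewrite -/x -/y; move: (sqn x + sqn y) (sqn h) (sqn (r - r')) (complex.Re _) hh.
by move=> e1 e2 e3 e4; lra.
Qed.

(** The constant coefficients 1 of [U] and [U'] cancel, so both differences of right-hand sides are
    orthogonal to those of the unknowns, and the real part in [energy_pointwise] integrates to
    zero. *)
Lemma energy_le a b c d F G al be U V A al' be' U' V' A' :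
  inL a b -> inL c d ->
  solution a b F al be U V A -> solution c d G al' be' U' V' A' ->
  n2 (fun t => al t - al' t) + n2 (fun t => be t - be' t) <=
  4 * (n2 (fun t => a (eT t) - c (eT t)) + n2 (fun t => b (eT t) - d (eT t))).
Proof.
move=> hab hcd S S'.
have [cal cbe cU cV] := And4 (sol_cal S) (sol_cbe S) (sol_cU S) (sol_cV S).
have [cal' cbe' cU' cV'] := And4 (sol_cal S') (sol_cbe S') (sol_cU S') (sol_cV S').
have [ca cb] := inL_cLinf hab; have [cc cd] := inL_cLinf hcd.
have [dal dbe] := (cLinfB cal cal', cLinfB cbe cbe').
have [dU dV] := (cLinfB cU cU', cLinfB cV cV').
have [da db] := (cLinfB ca cc, cLinfB cb cd).
have iU : ip (fun t => U t - U' t) (fun t => al t - al' t) = 0.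
  apply: cl_ip (clB cal cal' (sol_clal S) (sol_clal S')) => // n n0.
  by rewrite fcB// (sol_U S)// (sol_U S')// subrr.
have iV : ip (fun t => V t - V' t) (fun t => be t - be' t) = 0.
  apply: cl_ip (clB cbe cbe' (sol_clbe S) (sol_clbe S')) => // n n0.
  by rewrite fcB// (sol_V S)// (sol_V S')// subrr.
pose J t := (U t - U' t) * conjc (al t - al' t) + (V t - V' t) * conjc (be t - be' t).
have cUal := cLinfM dU (cLinf_conj dal); have cVbe := cLinfM dV (cLinf_conj dbe).
have cJ : cLinf J by exact: cLinfD.
have J0 : int01 (fun t => complex.Re (J t)) = 0.
  have : cint J = 0 by rewrite cintD// -/(ip _ _) iU -/(ip _ _) iV addr0.
  by case.
have sab := LinfD (Linf_sqn da) (Linf_sqn db).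
have sal := LinfD (Linf_sqn dal) (Linf_sqn dbe).
rewrite /n2 -!int01D//; try exact: Linf_sqn.
rewrite -[leRHS]add0r -[X in X + _](mulr0 2) -J0 -!int01Z//; last by case: cJ.
have l1 := LinfM (Linf_cst 2) cJ.1; have l2 := LinfM (Linf_cst 4) sab.
rewrite -int01D//; apply: int01_le => //; first exact: LinfD.
have H1 := ae01_and (ae01_and (sol_a S) (sol_a S')) (inL_sqn hab).
have H2 := ae01_and (ae01_and (sol_eqU S) (sol_eqV S)) (ae01_and (sol_eqU S') (sol_eqV S')).
have H3 := sol_norm S'.
apply: ae01_imp2 (ae01_and H1 H2) H3 => t [[[la lc] ab] [[e1 e2] [e3 e4]]] e5.
apply: (energy_pointwise e1 e2 e3 e4).
  by rewrite e5; case/andP: (sol_A S').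
exact: quotient_diff_le.
Qed.

(** Bounding the zeroth coefficients by the norms gives A^4 (1 + |F_0|^2) <= A^2, and A^2 >= 1/2.
    The bound controls the weight of A^2 - A'^2 when F_0 is recovered as a quotient. *)
Lemma solution_sqn_le1 a b F al be U V A : solution a b F al be U V A -> sqn (F 0) <= 1.
Proof.
move=> S; have /andP[A1 A2] := sol_A S.
have := sqn_fc_le 0 (sol_cal S); have := sqn_fc_le 0 (sol_cbe S).
rewrite (sol_al0 S) (sol_be0 S) sqnM !sqn_toC => h1 h2.
have h3 : n2 al + n2 be = A ^+ 2.
  rewrite /n2 -int01D; try exact: Linf_sqn (sol_cal S); try exact: Linf_sqn (sol_cbe S).
  rewrite -[RHS](@int01_cst R); apply: int01_ae_eq => //; last exact: sol_norm S.
  exact: LinfD (Linf_sqn (sol_cal S)) (Linf_sqn (sol_cbe S)).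
have := sqn_ge0 (F 0).
move: h1 h2 h3 A1 A2; move: (n2 al) (n2 be) (A ^+ 2) (sqn (F 0)) => x y B s.
rewrite expr2 => h1 h2 h3 A1 A2 s0; rewrite leNgt; apply/negP => s1.
have B2 : 0 < B * B by rewrite mulr_gt0//; lra.
have := mulr_gt0 B2 (_ : 0 < s - 1); rewrite subr_gt0 => /(_ s1).
by have : 0 <= B * (2 * B - 1) by [apply: mulr_ge0; lra]; nra.
Qed.

(** Clearing the denominator A^2 leaves the differences of beta^(0) and of alpha^(0), the latter
    weighted by |G_0| <= 1. The squared constant is 2 for the sum of two terms, 4 from the energy
    estimate and 4 from A^4 >= 1/4: altogether 32, below 8^2. *)
Lemma F0_lipschitz (eps : R) a b c d F G : 0 < eps ->
  inBeps eps a b -> inBeps eps c d -> is_nlft F a b -> is_nlft G c d ->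
  cabs (F 0 - G 0) <=
  8 * Num.sqrt (L2norm (fun z => a z - c z) ^+ 2 + L2norm (fun z => b z - d z) ^+ 2).
Proof.
move=> eps0 hab hcd hF hG.
have [al [be [U [V [A S]]]]] := nlft_solution eps0 hab hF.
have [al' [be' [U' [V' [A' S']]]]] := nlft_solution eps0 hcd hG.
rewrite !L2norm_sqr.
have := energy_le (inBeps_inL hab) (inBeps_inL hcd) S S'.
set X := n2 (fun t => al t - _); set Y := n2 (fun t => be t - _).
set D := n2 _ + n2 _ => XY.
have D0 : 0 <= D by rewrite addr_ge0// n2_ge0.
have hx := sqn_fc_le 0 (cLinfB (sol_cal S) (sol_cal S')).
have hy := sqn_fc_le 0 (cLinfB (sol_cbe S) (sol_cbe S')).
rewrite -/X -/Y !fcB ?(sol_al0 S, sol_al0 S', sol_be0 S, sol_be0 S') in hx hy;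
  try exact: sol_cal S; try exact: sol_cal S'; try exact: sol_cbe S; try exact: sol_cbe S'.
have G1 := solution_sqn_le1 S'.
have key : (F 0 - G 0) * toC (A ^+ 2) =
  (F 0 * toC (A ^+ 2) - G 0 * toC (A' ^+ 2)) + - (G 0 * (toC (A ^+ 2) - toC (A' ^+ 2))).
  by ring.
have : sqn ((F 0 - G 0) * toC (A ^+ 2)) <= 8 * D.
  rewrite key; apply: le_trans (sqnD_le _ _) _; rewrite sqnN sqnM.
  have := ler_piMl (sqn_ge0 (toC (A ^+ 2) - toC (A' ^+ 2))) G1.
  move: hx hy XY; move: (sqn _) (sqn _) (sqn _ * sqn _) => x y w.
  by move=> *; lra.
rewrite sqnM sqn_toC => hs; have /andP[A1 _] := sol_A S.
rewrite -[8]ger0_norm ?ler0n// -sqrtr_sqr -sqrtrM ?sqr_ge0//.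
rewrite cabsE ler_wsqrtr//.
have := sqn_ge0 (F 0 - G 0).
move: hs A1 D0; move: (sqn _) (A ^+ 2) D {XY} => s B D; rewrite !expr2.
move=> hs A1 D0 s0.
have B4 : 2^-1 * 2^-1 <= B * B by apply: ler_pM; lra.
have := ler_wpM2l s0 B4.
by lra.
Qed.

End Factorization.

(** Rational bounds suffice: |a(oo)| <= 1 and 2^(-1/2) >= 7/10 give eps <= 3/10, while 3^(3/2) <= 6
    gives eta <= 3. *)
Lemma eta_eps_le1 (R : realType) (eps : R) (a b : R[i] -> R[i]) : 0 < eps ->
  inBeps eps a b -> 3 `^ (3 / 2) / 2 * eps <= 1.
Proof.
move=> eps0 hB; have hL := inBeps_inL hB; have [_ [_ hinf]] := hB.
have [ca _] := inL_cLinf hL; have [a1 _] := inL_sqn_le1 hL.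
have f1 : cabs (ext_inf a) <= 1.
  rewrite cabs_le_sqn ?ler01// expr1n.
  exact: le_trans (sqn_fc_le 0 ca) (n2_le1 ca a1).
have h7 : 7 / 10 <= Num.sqrt (2^-1 : R).
  rewrite -[leLHS]ger0_norm; last by lra.
  by rewrite -sqrtr_sqr ler_wsqrtr// expr2; lra.
have h3 : 3 `^ (3 / 2) <= 6 :> R.
  have -> : 3 / 2 = 1 + 2^-1 :> R by field.
  rewrite powRD ?pnatr_eq0 ?implybT// powRr1 ?ler0n// powR12_sqrt ?ler0n//.
  have : Num.sqrt (3 : R) <= 2.
    rewrite -[leRHS]ger0_norm ?ler0n// -sqrtr_sqr ler_wsqrtr// expr2; lra.
  lra.
have h0 := powR_ge0 (3 : R) (3 / 2).
move: h0 h3 h7; move: (_ `^ _) (Num.sqrt _) hinf => x s hinf x0 x6 s7.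
have : eps <= 3 / 10 by lra.
nra.
Qed.

Theorem theorem7p5 (R : realType) (eps : R) (heps : 0 < eps)
  (a b c d : R[i] -> R[i]) (F G : int -> R[i]) :
  inBeps eps a b -> inBeps eps c d ->
  ell2 F -> is_nlft F a b ->
  ell2 G -> is_nlft G c d ->
  let eta : R := 3 `^ (3 / 2) / 2 in
  cabs (F 0 - G 0) <=
    (8 + 2 `^ (5 / 2)) * (eta * eps) `^ (- (3 / 2)) *
    Num.sqrt (L2norm (fun z => a z - c z) ^+ 2 + L2norm (fun z => b z - d z) ^+ 2).
Proof.
move=> hab hcd _ hF _ hG; cbv zeta; set eta := 3 `^ (3 / 2) / 2.
apply: le_trans (F0_lipschitz heps hab hcd hF hG) _.
apply: ler_wpM2r; first exact: sqrtr_ge0.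
have e1 : eta * eps <= 1 by exact: eta_eps_le1 heps hab.
have e0 : 0 < eta * eps by rewrite mulr_gt0// divr_gt0// powR_gt0.
(* A negative power of a number in (0, 1] is at least 1, so the asserted constant is at least 8. *)
have p1 : 1 <= (eta * eps) `^ (- (3 / 2)).
  rewrite powRN invf_ge1 ?powR_gt0//.
  apply: (@le_trans _ _ (1 `^ (3 / 2))); last by rewrite powR1.
  apply: ge0_ler_powR; rewrite ?nnegrE; first by rewrite divr_ge0.
  - exact: ltW.
  - exact: ler01.
  - exact: e1.
have p2 := powR_ge0 (2 : R) (5 / 2).
by nra.
Qed.
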